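(* Let $\bar p\in M$ be a weak Pareto optimum of $\min_{p\in M}F(p)$ such that, for some $\alpha>0$ and $r>0$, $$\|v(p)\|^2\ge\alpha\,\varphi(p)\quad\text{for each }p\in\mathbb{B}(\bar p,r).$$ Then there exists $\delta>0$ such that, for any sequence $\{p_k\}$ generated by the inexact descent algorithm (with associated step sizes $\{t_k\}$ and directions $\{v_k\}$, each $v_k$ being s-compatible at $p_k$) with initial point $p_0\in\mathbb{B}(\bar p,\delta)$, if the step sizes satisfy $\underline{t}:=\inf_{k\ge0}t_k>0$, then $\{p_k\}$ stays in $\mathbb{B}(\bar p,r)$, converges linearly to a weak Pareto optimum $p^*$ of $\min_{p\in M}F(p)$, and satisfies $$\mathrm{d}^2(p_k,p^* )\le\mu\,\varphi(p_k)\le\mu\rho^{2k}\varphi(p_0)\quad\text{for each }k\in\mathbb{N},$$ where $\rho:=\sqrt{1-\frac{\alpha\beta\underline{t}(1-\sqrt{\sigma})^2}{2}}$ and $\mu:=\frac{2R}{(1-\rho)^2\beta}$.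
   Context: $M$ is a connected, complete, $m$-dimensional Riemannian manifold with Riemannian distance $\mathrm{d}$; $\mathbb{B}(p,r)=\{q\in M:\mathrm{d}(p,q)\le r\}$; $\mathbb{N}=\{0,1,2,\dots\}$. $I=\{1,\dots,n\}$ and $F=(f_i)_{i\in I}:M\to\mathbb{R}^n$ is continuously differentiable, with $JF(p)(v):=(\langle\nabla f_i(p),v\rangle)_{i\in I}$ for $v\in T_pM$. For $x,y\in\mathbb{R}^n$, $x\preceq y$ means $x_i\le y_i$ for all $i$, and $x\prec y$ means $x_i<y_i$ for all $i$. A point $p\in M$ is a Pareto critical point of $F$ if there is no $v\in T_pM$ with $\langle\nabla f_i(p),v\rangle<0$ for all $i\in I$. A point $p$ is a weak Pareto optimum of $\min_{p\in M}F(p)$ if there is no $q\in M$ with $F(q)\prec F(p)$. For $p\in M$, $\alpha_p(v):=\max_{i\in I}\langle\nabla f_i(p),v\rangle+\frac12\|v\|^2$ ($v\in T_pM$); $v(p)$ denotes the unique minimizer of $\alpha_p$ over $T_pM$ (the steepest descent direction at $p$), and $\alpha_p^*:=\alpha_p(v(p))$. For $\sigma\in[0,1)$, $D_\sigma(p):=\{v\in T_pM:\alpha_p(v)\le(1-\sigma)\alpha_p^*\}$. A vector $v\in T_pM$ is s-compatible at $p$ if $v=-\sum_{i\in I}\alpha_i\nabla f_i(p)$ for some $\alpha_i\in[0,1]$ with $\sum_{i\in I}\alpha_i=1$. The function $\varphi:M\to\mathbb{R}$ is $\varphi(p):=\sup_{q\in M}\min_{i\in I}(f_i(p)-f_i(q))$.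 Inexact descent algorithm: fix $\sigma,\beta\in(0,1)$, $R\in[1,+\infty)$ and $p_0\in M$. At iteration $k=0,1,2,\dots$: if $p_k$ is a Pareto critical point, stop; otherwise choose $v_k\in D_\sigma(p_k)$, let $\gamma_k$ be the geodesic with $\gamma_k(0)=p_k$, $\gamma_k'(0)=v_k$, choose any $t_k\in(0,R]$ with $F(\gamma_k(t_k))\preceq F(p_k)+\beta t_kJF(p_k)(v_k)$, and set $p_{k+1}:=\gamma_k(t_k)$. Generated sequences are understood to be infinite (the algorithm does not stop). $\{p_k\}$ converges linearly to $p^*$ means that there exist $C>0$ and $\theta\in(0,1)$ with $\mathrm{d}(p_k,p^* )\le C\theta^k$ for all $k$. *)

(* Defs.v *)
From mathcomp Require Import all_boot all_order all_algebra.
From mathcomp Require Import all_classical all_reals all_analysis.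

Set Implicit Arguments.
Unset Strict Implicit.
Unset Printing Implicit Defensive.

Import Order.TTheory GRing.Theory Num.Theory.
Import numFieldNormedType.Exports.

Local Open Scope classical_set_scope.
Local Open Scope ring_scope.

Section Smooth.
Context {R : realType} {m : nat}.

Definition basis_vec (j : 'I_m) : 'rV[R]_m := delta_mx 0 j.

Definition partial (j : 'I_m) (f : 'rV[R]_m -> R) : 'rV[R]_m -> R :=
  fun x => 'D_(basis_vec j) f x.

(* Class C^k on U; only meant for open U. *)
Fixpoint Ck (k : nat) (U : set 'rV[R]_m) (f : 'rV[R]_m -> R) : Prop :=
  match k with
  | 0 => forall x, U x -> {for x, continuous f}
  | k'.+1 => (forall x, U x -> differentiable f x) /\
             (forall j, Ck k' U (partial j f))
  end.

Definition smooth_on (U : set 'rV[R]_m) (f : 'rV[R]_m -> R) : Prop :=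
  forall k, Ck k U f.

End Smooth.

(* A homeomorphism of an open part of M onto an open part of R^m. Both maps are
   total; their values outside [cdom] and outside [cran] are irrelevant. *)
Record chart (R : realType) (m : nat) (M : topologicalType) := Chart {
  cdom : set M ;
  cmap :> M -> 'rV[R]_m ;
  cinv : 'rV[R]_m -> M ;
  cdom_open : open cdom ;
  cran_open : open (cmap @` cdom) ;
  cmapK : forall p, cdom p -> cinv (cmap p) = p ;
  cmap_continuous : forall p, cdom p -> {for p, continuous cmap} ;
  cinv_continuous : forall x, (cmap @` cdom) x -> {for x, continuous cinv}
}.

Definition cran (R : realType) (m : nat) (M : topologicalType)
  (c : chart R m M) : set 'rV[R]_m := c @` cdom c.

(* The preferred chart [chart_at p] is used to represent T_pM, see below. *)
Record smoothManifold (R : realType) (m : nat) := SmoothManifold {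
  carrier :> topologicalType ;
  atlas : set (chart R m carrier) ;
  chart_at : carrier -> chart R m carrier ;
  manifold_hausdorff : hausdorff_space carrier ;
  manifold_second_countable : @second_countable carrier ;
  atlas_chart_at : forall p, atlas (chart_at p) ;
  cdom_chart_at : forall p, cdom (chart_at p) p ;
  atlas_compatible : forall c c', atlas c -> atlas c' -> forall j : 'I_m,
    smooth_on (c @` (cdom c `&` cdom c')) (fun x => c' (cinv c x) 0 j)
}.

Section Tangent.
Context {R : realType} {m : nat} {M : smoothManifold R m}.

(* A tangent vector at p is given by its components in the chart [chart_at p]. *)
Definition tangent (p : M) : Type := 'rV[R]_m.

(* The vector at [cinv c x] whose components in the chart c are w. *)
Definition of_chart (c : chart R m M) (x w : 'rV[R]_m) : tangent (cinv c x) :=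
  'D_w (chart_at (cinv c x) \o cinv c) x.

Definition dfun (f : M -> R) (p : M) (v : tangent p) : R :=
  'D_(v : 'rV[R]_m) (f \o cinv (chart_at p)) (chart_at p p).

Definition velocity (gamma : R -> M) (t : R) : tangent (gamma t) :=
  derive1 (chart_at (gamma t) \o gamma) t.

Definition C1_fun (f : M -> R) : Prop :=
  forall c, atlas c -> Ck 1 (cran c) (f \o cinv c).

Definition C1_curve (gamma : R -> M) : Prop :=
  continuous gamma /\
  forall c, atlas c -> forall t, cdom c (gamma t) ->
    derivable (c \o gamma) t 1 /\ {for t, continuous (derive1 (c \o gamma))}.

End Tangent.

(* [gram B c x] is the matrix, in the coordinates of c, of the field of bilinear
   forms B at the point of coordinates x. *)
Definition gram (R : realType) (m : nat) (M : smoothManifold R m)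
    (B : forall p : M, tangent p -> tangent p -> R)
    (c : chart R m M) (x : 'rV[R]_m) : 'M[R]_m :=
  \matrix_(i, j) B (cinv c x) (of_chart c x (basis_vec i))
                              (of_chart c x (basis_vec j)).

Definition form_of_mx (R : realType) (m : nat) (M : smoothManifold R m)
    (A : M -> 'M[R]_m) (p : M) (u v : tangent p) : R :=
  ((u : 'rV[R]_m) *m A p *m (v : 'rV[R]_m)^T) 0 0.

(* [metric_mx p] is the matrix of the inner product of T_pM in the chart
   [chart_at p]. *)
Record riemannianMetric (R : realType) (m : nat) (M : smoothManifold R m) :=
  RiemannianMetric {
  metric_mx : M -> 'M[R]_m ;
  metric_sym : forall p, (metric_mx p)^T = metric_mx p ;
  metric_posdef : forall p (v : 'rV[R]_m), v != 0 ->
    0 < form_of_mx metric_mx (v : tangent p) v ;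
  metric_smooth : forall c, atlas c -> forall i j : 'I_m,
    smooth_on (cran c) (fun x => gram (form_of_mx metric_mx) c x i j)
}.

Section Riemannian.
Context {R : realType} {m : nat} {M : smoothManifold R m}.
Variable g : riemannianMetric M.

Definition inner (p : M) (u v : tangent p) : R := form_of_mx (metric_mx g) u v.

Definition tnorm (p : M) (v : tangent p) : R := Num.sqrt (inner v v).

(* The components g^{ij} d_j f of the Riesz representative of the differential. *)
Definition grad (f : M -> R) (p : M) : tangent p :=
  (\row_j dfun f (basis_vec j : tangent p)) *m invmx (metric_mx g p).

Definition curve_length (gamma : R -> M) : \bar R :=
  (\int[lebesgue_measure]_(t in `[0%R, 1%R]) (tnorm (velocity gamma t))%:E)%E.

(* A piecewise C^1 path from p to q, as the list of its C^1 pieces, each of them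
   parametrized by [0, 1]. A C^1 map from [0, 1] to M extends to a C^1 curve
   defined on R, hence taking pieces defined on R is not a restriction. *)
Fixpoint path_from_to (p : M) (s : seq (R -> M)) (q : M) : Prop :=
  match s with
  | [::] => p = q
  | gamma :: s' =>
      [/\ C1_curve gamma, gamma 0 = p & path_from_to (gamma 1) s' q]
  end.

(* The Riemannian distance; it is finite if M is connected. *)
Definition dist (p q : M) : \bar R :=
  ereal_inf [set (\sum_(gamma <- s) curve_length gamma)%E | s in
             [set s | path_from_to p s q]].

Definition cball (p : M) (r : R) : set M := [set q | (dist p q <= r%:E)%E].

Definition complete_metric : Prop :=
  forall u : nat -> M,
    (forall e : R, 0 < e -> exists N : nat, forall i j : nat,
      (N <= i)%N -> (N <= j)%N -> (dist (u i) (u j) <= e%:E)%E) ->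
    exists p : M, forall e : R, 0 < e -> exists N : nat, forall i : nat,
      (N <= i)%N -> (dist (u i) p <= e%:E)%E.

Definition christoffel (c : chart R m M) (x : 'rV[R]_m) (k i j : 'I_m) : R :=
  let G a b := fun y => gram inner c y a b in
  2^-1 * \sum_l invmx (gram inner c x) k l *
    (partial i (G j l) x + partial j (G i l) x - partial l (G i j) x).

(* Geodesics are defined on the whole of R, as they are in a complete manifold. *)
Definition geodesic (gamma : R -> M) : Prop :=
  continuous gamma /\
  forall c, atlas c -> forall t, cdom c (gamma t) ->
    let x := c \o gamma in
    [/\ derivable x t 1, derivable (derive1 x) t 1 &
        forall k : 'I_m,
          derive1 (derive1 x) t 0 k + \sum_i \sum_j christoffel c (x t) k i j *
            derive1 x t 0 i * derive1 x t 0 j = 0].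

End Riemannian.

Section Multiobjective.
Context {R : realType} {m n : nat} {M : smoothManifold R m}.
Variables (g : riemannianMetric M) (F : M -> 'rV[R]_n.+1).

Definition vle (x y : 'rV[R]_n.+1) : Prop := forall i, x 0 i <= y 0 i.
Definition vlt (x y : 'rV[R]_n.+1) : Prop := forall i, x 0 i < y 0 i.

Definition vmax (x : 'rV[R]_n.+1) : R := \big[Num.max/x 0 ord0]_i x 0 i.
Definition vmin (x : 'rV[R]_n.+1) : R := \big[Num.min/x 0 ord0]_i x 0 i.

Definition component (i : 'I_n.+1) : M -> R := fun p => F p 0 i.

Definition C1_map : Prop := forall i, C1_fun (component i).

Definition JF (p : M) (v : tangent p) : 'rV[R]_n.+1 :=
  \row_i inner g (grad g (component i) p) v.

Definition pareto_critical (p : M) : Prop :=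
  ~ exists v : tangent p, forall i, inner g (grad g (component i) p) v < 0.

Definition weak_pareto (p : M) : Prop := ~ exists q : M, vlt (F q) (F p).

Definition alpha_fun (p : M) (v : tangent p) : R :=
  vmax (JF v) + 2^-1 * tnorm g v ^+ 2.

Definition steepest (p : M) : tangent p :=
  xget (0 : 'rV[R]_m)
    [set v | forall w : tangent p, alpha_fun (v : tangent p) <= alpha_fun w].

Definition alpha_star (p : M) : R := alpha_fun (steepest p).

Definition D_set (sigma : R) (p : M) (v : tangent p) : Prop :=
  alpha_fun v <= (1 - sigma) * alpha_star p.

Definition s_compatible (p : M) (v : tangent p) : Prop :=
  exists a : 'I_n.+1 -> R,
    [/\ forall i, 0 <= a i <= 1, \sum_i a i = 1 &
        (v : 'rV[R]_m) =
          - \sum_i a i *: (grad g (component i) p : 'rV[R]_m)].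

Definition phi (p : M) : \bar R :=
  ereal_sup [set (vmin (F p - F q))%:E | q in [set: M]].

(* Infinite runs only: no iterate is Pareto critical. *)
Definition generated (sigma beta Rmax : R) (p : nat -> M)
    (v : forall k, tangent (p k)) (t : nat -> R) : Prop :=
  forall k,
    [/\ ~ pareto_critical (p k), D_set sigma (v k), 0 < t k <= Rmax &
        exists gamma : R -> M,
          [/\ geodesic g gamma, gamma 0 = p k,
              velocity gamma 0 = v k :> 'rV[R]_m,
              vle (F (gamma (t k))) (F (p k) + (beta * t k) *: JF (v k)) &
              p k.+1 = gamma (t k)]].

Definition converges_linearly (p : nat -> M) (pstar : M) : Prop :=
  exists C theta : R, [/\ 0 < C, 0 < theta < 1 &
    forall k, (dist g (p k) pstar <= (C * theta ^+ k)%:E)%E].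

End Multiobjective.

(* Main.v *)
Require Import Defs.
From mathcomp Require Import all_boot all_order all_algebra.
From mathcomp Require Import all_classical all_reals all_analysis.
From mathcomp Require Import ring lra.

Import Order.TTheory GRing.Theory Num.Theory.
Import numFieldNormedType.Exports.

Local Open Scope classical_set_scope.
Local Open Scope ring_scope.

(** Why the theorem holds.  Write [s_k] for the norm of the steepest descent
    direction at [p_k], [w_k] for the norm of [v_k] and [f_k] for the gap
    [phi (p_k)].  Comparing the steepest direction with its own multiples gives
    [alpha_star <= - s_k^2 / 2], so a direction of [D_sigma] satisfies, in every
    component, [JF v_k <= - ((1 - sigma) s_k^2 / 2 + w_k^2 / 2)]
    ([D_set_descent]).  Through the Armijo condition, [phi] then loses at least
    [beta t_k ((1 - sigma) s_k^2 / 2 + w_k^2 / 2)] at each step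
    ([generated_step]).  As long as [p_k] is in the ball of radius [r], where
    [s_k^2 >= alpha f_k], this single inequality has three consequences.

    - [t_k w_k <= K (sqrt f_k - sqrt f_(k+1))] by the arithmetic-geometric
      inequality ([step_length_sqrt]).  The constant [K] involves neither
      the step sizes nor [rho], and the right-hand side telescopes: the total
      length of the run is at most [K (sqrt f_0)].  Since [phi] vanishes at
      the weak Pareto optimum [pbar] and is small near it, a [delta] chosen
      before the step sizes keeps the whole run in the ball.
    - [sqrt f_(k+1) <= rho sqrt f_k] ([step_contraction]).
    - [(t_k w_k)^2 <= (2 Rmax / beta) f_k] ([step_length_sqr]).

    The last two bound the distances [d(p_k, p_(k+j))] by a geometric series,
    which yields the limit [pstar], the linear rate and the constant [mu]
    ([geometric_limit]); [phi (p_k) -> 0] forces [pstar] to be a weak Pareto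
    optimum ([weak_pareto_limit]).

    Two geometric facts support this.  A step along a geodesic has length
    [t_k w_k], because geodesics have constant speed ([geodesic_speed_cst]);
    running the same geodesic backwards bounds the distance in the other
    direction too.  And [F] is continuous for the Riemannian distance, because
    small balls are contained in small neighbourhoods ([dist_small_nbhs]): a
    truncated coordinate distance is Lipschitz along every [C^1] curve.  The
    latter rests on a mean value inequality for functions that are only
    controlled by a Dini-type condition ([dini_le_integral]). *)

(** * Mean value inequalities on the line *)

(** The hypothesis says that the upper Dini derivative of [D] is at most [0] on
    both sides of every point.  For each slope [k > 0], the supremum of the
    points up to which [D] stays below the line of slope [k] through
    [(a, D a)] can only be [b]. *)
Lemma dini_nonincreasing (R : realType) (D : R -> R) (a b : R) : a <= b ->
  (forall t : R, a <= t <= b -> forall e : R, 0 < e ->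
    \forall s \near t, (D s - D t) * (s - t) <= e * (s - t) ^+ 2) ->
  D b <= D a.
Proof.
move=> ab dD; apply/ler_addgt0Pr => e e0.
(* The [+ 1] keeps the denominator positive when [a = b]. *)
have k0 : 0 < e / (b - a + 1) by apply: divr_gt0 => //; lra.
set k := e / (b - a + 1) in k0.
pose A := [set t | a <= t <= b /\
  forall s, a <= s <= t -> D s <= D a + k * (s - a)].
have Aa : A a.
  split; first by rewrite lexx ab.
  move=> s; rewrite -eq_le => /eqP <-.
  by rewrite subrr mulr0 addr0.
have supA : has_sup A.
  by split; [exists a | exists b => t [/andP[]]].
have ubA := sup_upper_bound supA.
set c := sup A.
have ac : a <= c by exact: ubA.
have cb : c <= b by apply: ge_sup; [exists a | move=> t [/andP[]]].
have [d /= d0 hd] := dD c (introT andP (conj ac cb)) k k0.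
have hc s : `|s - c| < d -> (D s - D c) * (s - c) <= k * (s - c) ^+ 2.
  by move=> sc; apply: hd; rewrite /= distrC.
have below s : a <= s < c -> D s <= D a + k * (s - a).
  move=> /andP[as_ sc].
  have cs0 : 0 < c - s by lra.
  have [t [tI At]] := sup_adherent cs0 supA.
  rewrite -/c => st; apply: At.
  by rewrite as_ /=; lra.
have Dc : D c <= D a + k * (c - a).
  move: ac; rewrite le_eqVlt => /orP[/eqP <-|ac]; first by rewrite subrr mulr0 addr0.
  pose s := Num.max ((a + c) / 2) (c - d / 2).
  have sc : s < c by rewrite gt_max; apply/andP; split; lra.
  have as_ : a <= s by rewrite le_max; apply/orP; left; lra.
  have sd : c - d / 2 <= s by rewrite le_max lexx orbT.
  have /hc : `|s - c| < d by rewrite ltr0_norm; lra.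
  rewrite expr2 mulrA ler_nM2r ?subr_lt0// => h.
  have := below s; rewrite as_ sc => /(_ isT); lra.
have cbE : c = b.
  apply/eqP; rewrite eq_le cb /= leNgt; apply/negP => cltb.
  pose t := Num.min b (c + d / 2).
  have ct : c < t by rewrite lt_min cltb; lra.
  have td : t <= c + d / 2 by rewrite ge_min lexx orbT.
  have tb : t <= b by rewrite ge_min lexx.
  suff /ubA : A t by rewrite leNgt ct.
  split; first by apply/andP; split; lra.
  move=> s /andP[as_ st].
  have [sc|cs|->//] := ltgtP s c; first by apply: below; rewrite as_.
  have /hc : `|s - c| < d by rewrite gtr0_norm; lra.
  rewrite expr2 mulrA ler_pM2r ?subr_gt0// => h; lra.
move: Dc; rewrite cbE => /le_trans; apply.
rewrite lerD2l /k -mulrA ger_pMr// mulrC ler_pdivrMr; lra.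
Qed.

Lemma is_derive_near (R : realType) (V : normedModType R) (x : R -> V) (t : R) l :
  is_derive t (1 : R) x l -> forall e, 0 < e ->
  \forall s \near t, `|x s - x t - (s - t) *: l| <= e * `|s - t|.
Proof.
move=> [dx lE] e e0.
have : h^-1 *: (x (h *: 1 + t) - x t) @[h --> 0^'] --> l.
  rewrite -lE; exact: dx.
move=> /cvgrPdist_le /(_ e e0) [d /= d0 hd].
exists d => //= s; rewrite /ball_ /= distrC => sd.
have [->|st] := eqVneq s t; first by rewrite !subrr scale0r subrr !normr0 mulr0.
have st0 : s - t != 0 by rewrite subr_eq0.
have := hd (s - t); rewrite /= sub0r normrN => /(_ sd st0).
rewrite /GRing.scale /= mulr1 subrK => h.
rewrite -[x s - x t](scalerKV st0) -scalerBr normrZ mulrC.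
by rewrite ler_pM2r ?normr_gt0// distrC.
Qed.

(** Mean value inequality for a possibly nondifferentiable [u]: by the
    fundamental theorem of calculus, subtracting a primitive of [w] reduces it
    to [dini_nonincreasing]. *)
Lemma dini_le_integral (R : realType) (u w : R -> R) : continuous w ->
  (forall t : R, 0 <= t <= 1 -> forall e : R, 0 < e ->
    \forall s \near t, `|u s - u t| <= (w t + e) * `|s - t|) ->
  ((u 1 - u 0)%:E <= \int[lebesgue_measure]_(t in `[0%R, 1%R]) (w t)%:E)%E.
Proof.
move=> cw uw.
have intw (a b : R) : lebesgue_measure.-integrable `[a, b] (EFin \o w).
  apply: continuous_compact_integrable; first exact: segment_compact.
  exact: continuous_subspaceT.
(* Starting at [-1] makes [0] an interior point, where [G] is differentiable. *)
pose G (x : R) : R := \int[lebesgue_measure]_(t in `[-1, x]) w t.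
have dG (x : R) : 0 <= x <= 1 -> is_derive x (1 : R) G (w x).
  move=> /andP[x0 x1].
  have [dG GE] : derivable G x 1 /\ G^`()%classic x = w x.
    apply: (@continuous_FTC1_closed _ w (-1) x 2); [lra|exact: intw|lra|exact: cw].
  by apply: DeriveDef; [exact: dG|rewrite -derive1E; exact: GE].
have : u 1 - G 1 <= u 0 - G 0.
  apply: (@dini_nonincreasing _ (fun x => u x - G x)) => // t t01 e e0.
  have e20 : 0 < e / 2 by lra.
  near=> s.
  have hu : `|u s - u t| <= (w t + e / 2) * `|s - t| by near: s; exact: uw.
  have hG : `|G s - G t - (s - t) * w t| <= e / 2 * `|s - t|.
    by near: s; have := is_derive_near _ _ _ _ _ (dG t t01) _ e20.
  have [st|st] := leP t s.
    have st0 : 0 <= s - t by rewrite subr_ge0.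
    move: hu hG; rewrite !(ger0_norm st0) ler_norml ler_distl => /andP[_ hu] /andP[hG _].
    by rewrite expr2 mulrA ler_wpM2r ?subr_ge0//; lra.
  have st0 : s - t < 0 by rewrite subr_lt0.
  move: hu hG; rewrite !(ltr0_norm st0) ler_norml ler_distl => /andP[hu _] /andP[_ hG].
  by rewrite expr2 mulrA ler_wnM2r ?subr_le0 ?(ltW st)//; lra.
move=> uG.
have GE : G 1 - G 0 = \int[lebesgue_measure]_(t in `[0, 1]) w t.
  rewrite /G Rintegral_itvB ?bnd_simp ?lerN10 ?ler01//.
  rewrite Rintegral_itv_obnd_cbnd//; apply: integrableS (intw 0 1) => //.
  by apply: subset_itvr; rewrite bnd_simp.
have -> : (\int[lebesgue_measure]_(t in `[0%R, 1%R]) (w t)%:E)%E = (G 1 - G 0)%:E.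
  rewrite GE /Rintegral fineK; first by [].
  by have := intw 0 1; exact: integrable_fin_num.
by rewrite lee_fin; lra.
Unshelve. all: by end_near. Qed.

(** * Charts, velocities and the metric in coordinates *)

Lemma differentiable_row {R : realType} {V : normedModType R} {n : nat}
    (f : V -> 'rV[R]_n) (x : V) :
  (forall j, differentiable (fun y => f y 0 j) x) -> differentiable f x.
Proof.
move=> df.
have -> : f = \sum_(j < n) (fun y => f y 0 j *: (delta_mx 0 j : 'rV[R]_n)).
  by apply/funext => y; rewrite fct_sumE {1}(row_sum_delta (f y)).
by apply: differentiable_sum => j; exact: differentiableZl.
Qed.

Lemma is_derive_comp_curve {R : realType} {V W : normedModType R}
    (f : V -> W) (x : R -> V) (t : R) :
  derivable x t 1 -> differentiable f (x t) ->
  is_derive t (1 : R) (f \o x) ('d f (x t) (derive1 x t)).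
Proof.
move=> /[dup] dx /derivable1_diffP Dx df.
have Df : differentiable (f \o x) t by exact: differentiable_comp.
apply: DeriveDef; first exact/derivable1_diffP.
by rewrite deriveE// diff_comp//= derive1E'.
Qed.

Lemma mulmx_formE {R : realType} {n : nat} (A : 'M[R]_n) (u v : 'rV[R]_n) :
  (u *m A *m v^T) 0 0 = \sum_i \sum_j u 0 i * v 0 j * A i j.
Proof.
rewrite mxE exchange_big; apply: eq_bigr => j _.
rewrite !mxE mulr_suml; apply: eq_bigr => i _.
by rewrite mulrAC.
Qed.

Lemma cvg_sum_ord {R : realType} {V : normedModType R} {T : Type} (F : set_system T)
    (n : nat) (f : 'I_n -> T -> V) (a : 'I_n -> V) : Filter F ->
  (forall i, f i x @[x --> F] --> a i) ->
  \sum_i f i x @[x --> F] --> \sum_i a i.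
Proof. by move=> FF fa; apply: cvg_big => //; exact: add_continuous. Qed.

Section Charts.
Context {R : realType} {m : nat} {M : smoothManifold R m}.

Lemma transition_differentiable (c c' : chart R m M) (p : M) :
  atlas c -> atlas c' -> cdom c p -> cdom c' p ->
  differentiable (c' \o cinv c) (c p).
Proof.
move=> ac ac' cp c'p; apply: differentiable_row => j.
have [] := atlas_compatible ac ac' j 1 => + _.
by apply; exists p.
Qed.

(** The definition of [velocity] reads each [gamma t] in the chart preferred
    there, so the chart moves with [t].  The chain rule through the transition
    map expresses the velocity in one fixed chart. *)
Lemma velocity_in_chart (gamma : R -> M) (t : R) (c : chart R m M) :
  continuous gamma -> atlas c -> cdom c (gamma t) ->
  derivable (c \o gamma) t 1 ->
  velocity gamma t =
  'd (chart_at (gamma t) \o cinv c) (c (gamma t)) (derive1 (c \o gamma) t).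
Proof.
move=> cg ac cgt dx.
have dT : differentiable (chart_at (gamma t) \o cinv c) (c (gamma t)).
  apply: transition_differentiable => //; [exact: atlas_chart_at|exact: cdom_chart_at].
have [_ <-] := is_derive_comp_curve _ _ _ dx dT.
rewrite /velocity derive1E; apply: near_eq_derive.
have : \forall s \near t, cdom c (gamma s).
  by apply: cg; apply: open_nbhs_nbhs; split => //; exact: cdom_open.
by apply: filterS => s cgs /=; rewrite cmapK.
Qed.

Lemma of_chart_sum (c : chart R m M) (p : M) (w : 'rV[R]_m) :
  atlas c -> cdom c p ->
  'd (chart_at p \o cinv c) (c p) w =
  \sum_i w 0 i *: (of_chart c (c p) (basis_vec i) : 'rV[R]_m).
Proof.
move=> ac cp.
have dT : differentiable (chart_at p \o cinv c) (c p).
  apply: transition_differentiable => //; [exact: atlas_chart_at|exact: cdom_chart_at].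
rewrite {1}(row_sum_delta w) linear_sum; apply: eq_bigr => i _.
by rewrite linearZ /of_chart cmapK// deriveE.
Qed.

Variable g : riemannianMetric M.

(** In a fixed chart the squared speed is the usual quadratic form
    [g_ij x'_i x'_j], which can be differentiated along the curve. *)
Lemma inner_velocityE (gamma : R -> M) (t : R) (c : chart R m M) :
  continuous gamma -> atlas c -> cdom c (gamma t) ->
  derivable (c \o gamma) t 1 ->
  let v := derive1 (c \o gamma) t in
  inner g (velocity gamma t) (velocity gamma t) =
  \sum_i \sum_j v 0 i * v 0 j * gram (inner g) c (c (gamma t)) i j.
Proof.
move=> cg ac cgt dx v.
rewrite (velocity_in_chart _ _ _ cg ac cgt dx) -/v of_chart_sum//.
rewrite /inner /form_of_mx linear_sum/= !mulmx_suml summxE.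
apply: eq_bigr => i _; rewrite mulmx_sumr summxE; apply: eq_bigr => j _.
rewrite /gram mxE /inner /form_of_mx cmapK// linearZ/=.
by rewrite -!scalemxAl -scalemxAr !mxE mulrA.
Qed.

Lemma gram_continuous (c : chart R m M) (x : 'rV[R]_m) i j :
  atlas c -> cran c x -> {for x, continuous (fun y => gram (inner g) c y i j)}.
Proof. by move=> ac cx; exact: (metric_smooth g ac i j 0). Qed.

Lemma speed_continuous (gamma : R -> M) : C1_curve gamma ->
  continuous (fun t => tnorm g (velocity gamma t)).
Proof.
move=> [cg dg] t0.
set c := chart_at (gamma t0).
have ac : atlas c by exact: atlas_chart_at.
have ct0 : cdom c (gamma t0) by exact: cdom_chart_at.
have ct : \forall t \near t0, cdom c (gamma t).
  by apply: cg; apply: open_nbhs_nbhs; split => //; exact: cdom_open.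
pose v t := derive1 (c \o gamma) t.
pose E t := \sum_i \sum_j v t 0 i * v t 0 j * gram (inner g) c (c (gamma t)) i j.
have cE : {for t0, continuous E}.
  have cv i : {for t0, continuous (fun t => v t 0 i)}.
    apply: (continuous_comp (g := fun N : 'rV[R]_m => N 0 i) (dg c ac t0 ct0).2).
    exact: coord_continuous.
  apply: cvg_sum_ord => i.
  apply: cvg_sum_ord => j.
  apply: cvgM; first by apply: cvgM; exact: cv.
  apply: (continuous_comp (f := c \o gamma) (g := fun y => gram (inner g) c y i j)).
    by apply: continuous_comp; [exact: cg|exact: cmap_continuous].
  by apply: gram_continuous => //; exists (gamma t0).
have vE : \forall t \near t0, Num.sqrt (E t) = tnorm g (velocity gamma t).
  near=> t.
  have ctt : cdom c (gamma t) by near: t.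
  by rewrite /tnorm (inner_velocityE _ _ _ cg ac ctt (dg c ac t ctt).1).
rewrite /continuous_at -(nbhs_singleton vE).
apply: cvg_trans; last exact: (continuous_cvg _ (@sqrt_continuous R _) cE).
by apply: near_eq_cvg.
Unshelve. all: by end_near. Qed.

(** The transition map from a chart to itself is the identity near the point. *)
Lemma gram_chart_at (p : M) : gram (inner g) (chart_at p) (chart_at p p) = metric_mx g p.
Proof.
have cp := cdom_chart_at p.
have e i : of_chart (chart_at p) (chart_at p p) (basis_vec i) = basis_vec i :> 'rV[R]_m.
  rewrite /of_chart cmapK// -[RHS](derive_id (chart_at p p)); apply: near_eq_derive.
  have : \forall x \near chart_at p p, cran (chart_at p) x.
    apply: open_nbhs_nbhs; split; first exact: cran_open.
    by exists p.
  by apply: filterS => _ [q cq <-] /=; rewrite cmapK.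
apply/matrixP => i j; rewrite mxE /inner /form_of_mx !e cmapK//.
rewrite mulmx_formE (bigD1 i)//= (bigD1 j)//= !big1 ?addr0.
- by rewrite /basis_vec !mxE !eqxx !mul1r.
- by move=> k ki; rewrite big1// => l _; rewrite !mxE (negbTE ki) andbF !mul0r.
- by move=> k kj; rewrite !mxE (negbTE kj) andbF mulr0 mul0r.
Qed.

End Charts.

Lemma ler_coord_norm {R : realType} {n : nat} (w : 'rV[R]_n) i : `|w 0 i| <= `|w|.
Proof.
rewrite [leRHS]/Num.Def.normr/= mx_normrE.
exact: (le_bigmax _ (fun ij : 'I_1 * 'I_n => `|w ij.1 ij.2|) (0, i)).
Qed.

(** A positive definite form attains a positive minimum on the compact unit
    sphere; homogeneity does the rest. *)
Lemma posdef_lower_bound {R : realType} {n : nat} (A : 'M[R]_n) :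
  (forall v : 'rV[R]_n, v != 0 -> 0 < (v *m A *m v^T) 0 0) ->
  exists2 l : R, 0 < l & forall v : 'rV[R]_n, l * `|v| ^+ 2 <= (v *m A *m v^T) 0 0.
Proof.
move=> Apos.
pose S : set 'rV[R]_n := [set v | `|v| = 1].
pose Q (v : 'rV[R]_n) := (v *m A *m v^T) 0 0.
have QZ k v : Q (k *: v) = k ^+ 2 * Q v.
  by rewrite /Q linearZ/= -!scalemxAl -scalemxAr !mxE mulrA.
have Q0 : Q 0 = 0 by rewrite /Q !mul0mx mxE.
have [S0|S0] := pselect (S !=set0); last first.
  exists 1 => // v; suff -> : v = 0 by rewrite normr0 expr0n mulr0 -/(Q 0) Q0.
  apply/eqP/negP => /negP v0; apply: S0; exists (`|v|^-1 *: v).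
  by rewrite /S /= normrZ normfV normr_id mulVf// normr_eq0.
have cQ : continuous Q.
  move=> v; have -> : Q = fun v => \sum_i \sum_j v 0 i * v 0 j * A i j.
    by apply/funext => w; rewrite /Q mulmx_formE.
  apply: (cvg_sum_ord (nbhs v)) => i.
  apply: (cvg_sum_ord (nbhs v)) => j.
  apply: cvgM; last exact: cvg_cst.
  by apply: cvgM; exact: coord_continuous.
have cS : compact S.
  apply: bounded_closed_compact.
    by exists 1; split; [exact: num_real|move=> x x1 v /= ->; exact: ltW].
  rewrite (_ : S = Num.norm @^-1` [set 1]); last by [].
  apply: closed_comp; last exact: closed_eq.
  by move=> v _; exact: norm_continuous.
have [v0 /set_mem Sv0 minv0] := compact_EVT_min S0 cS (continuous_subspaceT cQ).
exists (Q v0).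
  apply: Apos; apply/eqP => v00.
  by move: Sv0; rewrite /S /= v00 normr0 => /eqP; rewrite eq_sym oner_eq0.
move=> v; have [->|v_neq0] := eqVneq v 0.
  by rewrite normr0 expr0n mulr0 -/(Q 0) Q0.
have nv : `|v| != 0 by rewrite normr_eq0.
have : Q v0 <= Q (`|v|^-1 *: v).
  by apply: minv0; apply/mem_set; rewrite /S /= normrZ normfV normr_id mulVf.
rewrite QZ exprVn mulrC ler_pdivlMr// exprn_gt0// normr_gt0//.
Qed.

(** * The Riemannian distance and the topology *)

Section Distance.
Context {R : realType} {m : nat} {M : smoothManifold R m}.
Variable g : riemannianMetric M.

Lemma curve_length_ge0 (gamma : R -> M) : (0 <= curve_length g gamma)%E.
Proof. by apply: integral_ge0 => t _; rewrite lee_fin sqrtr_ge0. Qed.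

Lemma dist_ge0 (p q : M) : (0 <= dist g p q)%E.
Proof.
apply: le_ereal_inf_tmp => _ [s _ <-]; apply: sume_ge0 => gamma _.
exact: curve_length_ge0.
Qed.

Lemma path_from_to_cat (s s' : seq (R -> M)) (p q q' : M) :
  path_from_to p s q -> path_from_to q s' q' -> path_from_to p (s ++ s') q'.
Proof.
elim: s p => [|gamma s IH] p /=; first by move=> ->.
by move=> [C1g gp sq] s'q; split => //; exact: IH.
Qed.

Lemma dist_triangle (p q q' : M) : (dist g p q' <= dist g p q + dist g q q')%E.
Proof.
have [->|fpq] := eqVneq (dist g p q) +oo%E.
  by rewrite addye ?leey// gt_eqF// (lt_le_trans _ (dist_ge0 _ _)).
have [->|fqq] := eqVneq (dist g q q') +oo%E.
  by rewrite addey ?leey// gt_eqF// (lt_le_trans _ (dist_ge0 _ _)).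
apply/lee_addgt0Pr => e e0.
have e20 : 0 < e / 2 by rewrite divr_gt0.
have dpq : dist g p q \is a fin_num by rewrite ge0_fin_numE ?dist_ge0// ltey.
have dqq : dist g q q' \is a fin_num by rewrite ge0_fin_numE ?dist_ge0// ltey.
have [_ [s sp <-] sl] := lb_ereal_inf_adherent e20 dpq.
have [_ [s' sp' <-] sl'] := lb_ereal_inf_adherent e20 dqq.
have : (dist g p q' <= \sum_(gamma <- s ++ s') curve_length g gamma)%E.
  by apply: ereal_inf_lbound; exists (s ++ s') => //; exact: path_from_to_cat sp sp'.
move=> /le_trans; apply; rewrite big_cat/=.
apply: le_trans (leeD (ltW sl) (ltW sl')) _.
rewrite -/(dist g p q) -/(dist g q q') addeACA -EFinD -splitr//.
Qed.

Lemma dist_le_curve (gamma : R -> M) : C1_curve gamma ->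
  (dist g (gamma 0%R) (gamma 1%R) <= curve_length g gamma)%E.
Proof.
move=> C1g; apply: ereal_inf_lbound; exists [:: gamma]; first by split.
by rewrite big_seq1.
Qed.

(** The inequality passes to concatenations of curves by the triangle
    inequality, then to the infimum of their lengths. *)
Lemma curve_nonexpansive_dist (psi : M -> R) :
  (forall gamma, C1_curve gamma ->
     (`|psi (gamma 1%R) - psi (gamma 0%R)|%:E <= curve_length g gamma)%E) ->
  forall p q, (`|psi q - psi p|%:E <= dist g p q)%E.
Proof.
move=> psi_le p q; apply: le_ereal_inf_tmp => _ [s sp <-].
elim: s p sp => [|gamma s IH] p /=.
  by move=> ->; rewrite subrr normr0 big_nil.
move=> [C1g <- sp]; rewrite big_cons.
apply: le_trans (leeD (psi_le _ C1g) (IH _ sp)).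
by rewrite -EFinD lee_fin [leRHS]addrC ler_distD.
Qed.

(** At [p] itself the bound is positive definiteness.  It persists nearby with a
    worse constant, since by continuity the coefficients of the metric move by
    at most [h], which changes the form by at most [h * m^2 * |w|^2]. *)
Lemma metric_comparison (p : M) : exists2 L : R, 0 < L &
  \forall x \near chart_at p p, forall w : 'rV[R]_m,
   `|w| <= L * Num.sqrt
     (\sum_i \sum_j w 0 i * w 0 j * gram (inner g) (chart_at p) x i j).
Proof.
set c := chart_at p; set x0 := c p.
have ac : atlas c by exact: atlas_chart_at.
have cx0 : cran c x0 by exists p => //; exact: cdom_chart_at.
have [l l0 hl] := posdef_lower_bound _ (@metric_posdef _ _ _ g p).
pose K : R := \sum_(i < m) \sum_(j < m) 1.
have K0 : 0 <= K by apply: sumr_ge0 => i _; apply: sumr_ge0.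
pose h := l / (2 * (K + 1)).
have h0 : 0 < h by rewrite /h divr_gt0// mulr_gt0//; lra.
have hK : h * K <= l / 2.
  rewrite /h invfM mulrA -[leRHS]mulr1 -mulrA ler_pM2l; last lra.
  by rewrite mulrC ler_pdivrMr; lra.
exists (Num.sqrt (2 / l)); first by rewrite sqrtr_gt0 divr_gt0.
have near_gram : \forall x \near x0, forall ij : 'I_m * 'I_m,
    `|gram (inner g) c x0 ij.1 ij.2 - gram (inner g) c x ij.1 ij.2| <= h.
  apply: (@filter_forall _ _ (fun (ij : 'I_m * 'I_m) x =>
    `|gram (inner g) c x0 ij.1 ij.2 - gram (inner g) c x ij.1 ij.2| <= h)
    (nbhs x0) (nbhs_filter x0)) => ij.
  by have /cvgrPdist_le /(_ h h0) := gram_continuous g c x0 ij.1 ij.2 ac cx0.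
apply: filterS near_gram => x hx w.
rewrite -sqrtrM; last by rewrite divr_ge0// ltW.
rewrite -[leLHS]ger0_norm// -sqrtr_sqr; apply: ler_wsqrtr.
rewrite mulrAC ler_pdivlMr//.
have := hl w; rewrite -gram_chart_at mulmx_formE -/c -/x0 => hlw.
suff form_le : \sum_i \sum_j w 0 i * w 0 j * gram (inner g) c x0 i j -
    \sum_i \sum_j w 0 i * w 0 j * gram (inner g) c x i j <= h * K * `|w| ^+ 2.
  have hKw : h * K * `|w| ^+ 2 <= l / 2 * `|w| ^+ 2 by rewrite ler_wpM2r// exprn_ge0.
  have arith (b a q0 q e : R) : b * a <= q0 -> q0 - q <= e -> e <= b / 2 * a ->
    a * b <= 2 * q by clear; lra.
  exact: arith hlw form_le hKw.
rewrite -sumrB /K mulr_sumr mulr_suml; apply: ler_sum => i _.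
rewrite -sumrB mulr_sumr mulr_suml; apply: ler_sum => j _.
rewrite -mulrBr mulr1 mulrC; apply: le_trans (ler_norm _) _.
rewrite normrM ler_pM ?normr_ge0//; first exact: (hx (i, j)).
by rewrite normrM expr2 ler_pM ?normr_ge0 ?ler_coord_norm.
Qed.

(** The coordinate distance to [p], truncated at [rho]: when the coordinate ball
    of radius [rho] lies inside the chart, the value [rho] extends it
    continuously to the whole manifold. *)
Definition chart_gap (p : M) (rho : R) (q : M) : R :=
  if `[< cdom (chart_at p) q >] then
    Num.min rho `|chart_at p q - chart_at p p| else rho.

Lemma chart_gap_far (p : M) (rho : R) (q : M) :
  (forall x, `|x - chart_at p p| <= rho -> cran (chart_at p) x) ->
  ~ (cinv (chart_at p) @` [set x | `|x - chart_at p p| <= rho]) q ->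
  chart_gap p rho q = rho.
Proof.
move=> ball_ran qK; rewrite /chart_gap; case: asboolP => // cq.
case: leP => // /ltW qp; case: qK.
by exists (chart_at p q) => //; rewrite cmapK.
Qed.

Lemma compact_chart_ball (p : M) (rho : R) :
  (forall x, `|x - chart_at p p| <= rho -> cran (chart_at p) x) ->
  compact (cinv (chart_at p) @` [set x | `|x - chart_at p p| <= rho]).
Proof.
move=> ball_ran; apply: continuous_compact.
  apply: continuous_in_subspaceT => x /set_mem /ball_ran; exact: cinv_continuous.
apply: bounded_closed_compact.
  exists (rho + `|chart_at p p|); split; [exact: num_real|move=> a ha x /= hx].
  apply: le_trans (ltW ha); rewrite -[x](subrK (chart_at p p)).
  by rewrite (le_trans (ler_normD _ _))// lerD2r.
have := @closed_closed_ball_ R _ (chart_at p p) rho.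
by rewrite /closed_ball_; under eq_set do rewrite distrC.
Qed.

(** Along a curve that is in the coordinate ball, the truncated distance varies
    at most as fast as the coordinates do, hence at most [L] times as fast as the
    arc length.  Off the ball it is locally constant: the ball is compact, hence
    closed in the Hausdorff space [M], so that its complement is open. *)
Lemma chart_gap_nonexpansive (p : M) (rho L : R) : 0 < L ->
  (forall x, `|x - chart_at p p| <= rho -> cran (chart_at p) x) ->
  (forall x, `|x - chart_at p p| <= rho -> forall w : 'rV[R]_m,
   `|w| <= L * Num.sqrt
     (\sum_i \sum_j w 0 i * w 0 j * gram (inner g) (chart_at p) x i j)) ->
  forall q q',
    (`|L^-1 * chart_gap p rho q' - L^-1 * chart_gap p rho q|%:E <= dist g q q')%E.
Proof.
move=> L0 ball_ran hL; apply: curve_nonexpansive_dist => gamma C1g.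
set c := chart_at p; set x0 := c p.
have ac : atlas c by exact: atlas_chart_at.
have [cg dg] := C1g.
pose w t := tnorm g (velocity gamma t).
have w0 t : 0 <= w t by exact: sqrtr_ge0.
pose u t := L^-1 * chart_gap p rho (gamma t).
have near_u (t e : R) : 0 < e ->
    \forall s \near t, `|u s - u t| <= (w t + e) * `|s - t|.
  move=> e0; set K := cinv c @` [set x | `|x - x0| <= rho].
  have [[x xrho xg]|gK] := pselect (K (gamma t)); last first.
    have Kclosed : closed K.
      apply: compact_closed; first exact: manifold_hausdorff.
      exact: compact_chart_ball.
    have nK : nbhs (gamma t) (~` K).
      by apply: open_nbhs_nbhs; split => //; exact: closed_openC.
    have {}nK : \forall s \near t, (~` K) (gamma s) by exact: (cg t _ nK).
    apply: filterS nK => s gsK; rewrite /u !chart_gap_far// subrr normr0.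
    by rewrite mulr_ge0// addr_ge0// ltW.
  have [q cq xq] := ball_ran x xrho.
  have cgt : cdom c (gamma t) by rewrite -xg -xq cmapK.
  have xE : x = c (gamma t) by rewrite -xg -xq cmapK.
  have [dx _] := dg c ac t cgt.
  have Le0 : 0 < L * e by rewrite mulr_gt0.
  have ct : \forall s \near t, cdom c (gamma s).
    by apply: cg; apply: open_nbhs_nbhs; split => //; exact: cdom_open.
  have dxd := is_derive_near _ _ _ _ _ (derivableP dx) _ Le0.
  near=> s.
  have cgs : cdom c (gamma s) by near: s.
  have hs : `|(c \o gamma) s - (c \o gamma) t - (s - t) *: 'D_1 (c \o gamma) t|
      <= L * e * `|s - t|.
    by near: s.
  rewrite /u /chart_gap !asboolT// -mulrBr normrM gtr0_norm ?invr_gt0//.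
  rewrite mulrC ler_pdivrMr// mulrAC.
  have minB a b : `|Num.min rho a - Num.min rho b| <= `|a - b|.
    case: (leP rho a) => ha; case: (leP rho b) => hb //.
    - by rewrite subrr normr0.
    - by rewrite !ger0_norm; lra.
    - by rewrite !ler0_norm; lra.
  apply: (le_trans (minB _ _)); apply: (le_trans (ler_dist_dist _ _)).
  rewrite opprB addrA subrK.
  apply: (@le_trans _ _ (L * e * `|s - t| + `|(s - t) *: 'D_1 (c \o gamma) t|)).
    apply: le_trans (lerD hs (lexx _)).
    by apply: le_trans (ler_normD _ _); rewrite subrK.
  rewrite normrZ [X in _ + X]mulrC -mulrDl ler_wpM2r// addrC mulrDl [e * L]mulrC lerD2r.
  rewrite mulrC /w /tnorm (inner_velocityE g _ _ _ cg ac cgt dx) -derive1E -xE.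
  exact: hL.
have dini (v : R -> R) : (forall t e : R, 0 < e ->
    \forall s \near t, `|v s - v t| <= (w t + e) * `|s - t|) ->
    ((v 1%R - v 0%R)%:E <= curve_length g gamma)%E.
  move=> hv; apply: dini_le_integral => [|t _ e e0]; last exact: hv.
  exact: speed_continuous.
have [u10|u01] := leP 0 (u 1 - u 0).
  by rewrite -/(u 1) -/(u 0) ger0_norm//; exact: dini.
rewrite -/(u 1) -/(u 0) ltr0_norm// opprB.
have -> : u 0 - u 1 = (- u 1) - (- u 0) by rewrite opprK addrC.
apply: (dini (fun t => - u t)) => t e e0; apply: filterS (near_u t e e0) => s.
by rewrite opprK [- _ + _]addrC distrC.
Unshelve. all: by end_near. Qed.

(** A path shorter than [rho / L] cannot bring [chart_gap] from [0] up to [rho],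
    so its ends are [rho]-close in coordinates.  Both orders of the arguments of
    [dist] are covered because the bound on [chart_gap] is symmetric. *)
Lemma dist_small_nbhs (p : M) (U : set M) : nbhs p U ->
  exists2 e : R, 0 < e &
    forall q, (dist g p q < e%:E)%E \/ (dist g q p < e%:E)%E -> U q.
Proof.
move=> pU; set c := chart_at p; set x0 := c p.
have cp : cdom c p by exact: cdom_chart_at.
have [L L0 nearL] := metric_comparison p.
have near_ran : \forall x \near x0, cran c x.
  by apply: open_nbhs_nbhs; split; [exact: cran_open|exists p].
have near_U : \forall x \near x0, U (cinv c x).
  by apply: cinv_continuous; [exists p|rewrite cmapK].
have [rho] := (nbhs_closedballP _ _).1 (filterI (filterI nearL near_ran) near_U).
rewrite closed_ballE// => hrho.
have hrhoP x : `|x - x0| <= rho%:num -> closed_ball_ Num.norm x0 rho%:num x.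
  by rewrite distrC.
have e0 : 0 < rho%:num / L by rewrite divr_gt0.
exists (rho%:num / L) => // q pq.
have gap_le := chart_gap_nonexpansive p rho%:num L L0
  (fun x xr => (hrho x (hrhoP x xr)).1.2) (fun x xr => (hrho x (hrhoP x xr)).1.1).
have gap_p : chart_gap p rho%:num p = 0.
  by rewrite /chart_gap asboolT// subrr normr0 min_r.
have : `|L^-1 * chart_gap p rho%:num q| < rho%:num / L.
  rewrite -lte_fin; case: pq => [/(le_lt_trans (gap_le p q))|/(le_lt_trans (gap_le q p))].
    by rewrite gap_p mulr0 subr0.
  by rewrite gap_p mulr0 sub0r normrN.
rewrite normrM gtr0_norm ?invr_gt0// mulrC ltr_pM2r ?invr_gt0//.
move=> /(le_lt_trans (ler_norm _)); rewrite /chart_gap; case: asboolP => [cq|_]; last by rewrite ltxx.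
rewrite gt_min ltxx /= => /ltW /hrhoP /hrho[_].
by rewrite cmapK.
Qed.

Lemma C1_fun_continuous (f : M -> R) : C1_fun f -> continuous f.
Proof.
move=> C1f p; set c := chart_at p.
have cp : cdom c p by exact: cdom_chart_at.
have cx : cran c (c p) by exists p.
have [df _] := C1f c (atlas_chart_at p).
have fc : {for c p, continuous (f \o cinv c)} by exact: differentiable_continuous (df _ cx).
have fcc : {for p, continuous ((f \o cinv c) \o c)}.
  by apply: continuous_comp => //; exact: cmap_continuous.
have near_f : \forall q \near p, ((f \o cinv c) \o c) q = f q.
  have : \forall q \near p, cdom c q.
    by apply: open_nbhs_nbhs; split => //; exact: cdom_open.
  by apply: filterS => q cq /=; rewrite cmapK.
rewrite /continuous_at -[f p](nbhs_singleton near_f).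
by apply: cvg_trans fcc; exact: near_eq_cvg.
Qed.

End Distance.

(** * Geodesics have constant speed *)

(** The algebra behind conservation of energy.  With [v] the velocity, [a] the
    acceleration and [d l i j] the derivative of [g_ij] in direction [l], the
    sum is the derivative of [g_ij v_i v_j].  Applying [G] to the geodesic
    equation gives [G a = - b], where [b] lowers the Christoffel terms.  The
    three derivatives of the metric in [b] all contribute the same total [S],
    so that [v b = (S + S - S) / 2]; the two acceleration terms are [- S / 2]
    each, and the third term is [S]. *)
Lemma christoffel_energy {R : realFieldType} {n : nat} (G Gi : 'M[R]_n)
    (d : 'I_n -> 'I_n -> 'I_n -> R) (v a : 'I_n -> R) :
  G *m Gi = 1%:M -> (forall i j, G i j = G j i) ->
  (forall k, a k + \sum_i \sum_j
     (2^-1 * \sum_l Gi k l * (d i j l + d j i l - d l i j)) * v i * v j = 0) ->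
  \sum_i \sum_j (a i * v j * G i j + v i * a j * G i j +
                 v i * v j * \sum_l v l * d l i j) = 0.
Proof.
move=> GGi Gsym aE.
pose S := \sum_i \sum_j \sum_l d i j l * v i * v j * v l.
pose b l := 2^-1 * \sum_i \sum_j (d i j l + d j i l - d l i j) * v i * v j.
have aE' k : a k = - \sum_l Gi k l * b l.
  apply/eqP; rewrite -addr_eq0 -[X in _ == X](aE k); apply/eqP; congr (_ + _).
  under [RHS]eq_bigr => i _.
    under eq_bigr => j _ do rewrite mulr_sumr !mulr_suml.
    rewrite exchange_big; over.
  rewrite exchange_big; apply: eq_bigr => l _.
  rewrite /b mulrCA !mulr_sumr; apply: eq_bigr => i _.
  by rewrite !mulr_sumr; apply: eq_bigr => j _; rewrite !mulrA.
have Ga i : \sum_j G i j * a j = - b i.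
  under eq_bigr => j _ do rewrite aE' mulrN mulr_sumr.
  rewrite sumrN exchange_big/=; congr (- _).
  under eq_bigr => l _ do under eq_bigr => j _ do rewrite mulrA.
  under eq_bigr => l _ do rewrite -mulr_suml.
  have GGiE l : \sum_j G i j * Gi j l = (i == l)%:R.
    by have /matrixP/(_ i l) := GGi; rewrite !mxE.
  under eq_bigr => l _ do rewrite GGiE.
  rewrite (bigD1 i)//= eqxx mul1r big1 ?addr0// => l li.
  by rewrite eq_sym (negbTE li) mul0r.
have vb : \sum_l v l * b l = 2^-1 * S.
  have S1 : \sum_l \sum_i \sum_j d i j l * v i * v j * v l = S.
    by rewrite exchange_big; apply: eq_bigr => i _; rewrite exchange_big.
  have S2 : \sum_l \sum_i \sum_j d j i l * v i * v j * v l = S.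
    rewrite -S1; apply: eq_bigr => l _; rewrite exchange_big.
    by apply: eq_bigr => i _; apply: eq_bigr => j _; ring.
  have S3 : \sum_l \sum_i \sum_j d l i j * v i * v j * v l = S.
    apply: eq_bigr => l _; apply: eq_bigr => i _; apply: eq_bigr => j _; ring.
  transitivity (2^-1 * (S + S - S)); last by rewrite addrK.
  rewrite -{1}S1 -{1}S2 -{1}S3 -sumrN -!big_split mulr_sumr; apply: eq_bigr => l _ /=.
  rewrite mulrCA -sumrN -!big_split/=; congr (_ * _); rewrite mulr_sumr.
  apply: eq_bigr => i _; rewrite mulr_sumr -sumrN -!big_split/=.
  apply: eq_bigr => j _; ring.
have T2 : \sum_i \sum_j v i * a j * G i j = - (2^-1 * S).
  rewrite -vb -sumrN; apply: eq_bigr => i _; rewrite -mulrN -Ga mulr_sumr.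
  by apply: eq_bigr => j _; ring.
have T1 : \sum_i \sum_j a i * v j * G i j = - (2^-1 * S).
  rewrite -T2 exchange_big; apply: eq_bigr => i _; apply: eq_bigr => j _.
  by rewrite Gsym [a j * _]mulrC.
have T3 : \sum_i \sum_j v i * v j * (\sum_l v l * d l i j) = S.
  rewrite /S [RHS]exchange_big; transitivity (\sum_i \sum_j \sum_l d l i j * v l * v i * v j).
    apply: eq_bigr => i _; apply: eq_bigr => j _; rewrite mulr_sumr.
    by apply: eq_bigr => l _; ring.
  apply: eq_bigr => i _; rewrite exchange_big; apply: eq_bigr => l _ //.
under eq_bigr => i _ do rewrite !big_split.
rewrite !big_split/= T1 T2 T3; lra.
Qed.

Lemma is_derive_affine {R : realType} {V : normedModType R} (f : R -> V) (a b s : R) :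
  derivable f (a * s + b) 1 ->
  is_derive s (1 : R) (fun s => f (a * s + b)) (a *: derive1 f (a * s + b)).
Proof.
move=> df; pose x (s : R) := a * s + b.
have dx : is_derive s (1 : R) x a.
  by apply: is_derive_eq; rewrite addr0 /GRing.scale/= mulr1 ?mulr0 ?addr0.
have Df : differentiable f (x s) by apply/derivable1_diffP.
have [dfx fxE] := is_derive_comp_curve f x s (@ex_derive _ _ _ _ _ _ _ dx) Df.
apply: DeriveDef; first exact: dfx.
rewrite [LHS]fxE derive1E (@derive_val _ _ _ _ _ _ _ dx) derive1E' //.
by rewrite -[X in 'd f _ X](mulr1 a) [LHS]linearZ.
Qed.

Section Geodesics.
Context {R : realType} {m : nat} {M : smoothManifold R m}.
Variable g : riemannianMetric M.

Lemma inner_sym (p : M) (u v : tangent p) : inner g u v = inner g v u.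
Proof.
rewrite /inner /form_of_mx.
transitivity ((u *m metric_mx g p *m v^T)^T 0 0); first by rewrite [RHS]mxE.
by rewrite !trmx_mul trmxK Defs.metric_sym mulmxA.
Qed.

Lemma gram_sym (c : chart R m M) (x : 'rV[R]_m) i j :
  gram (inner g) c x i j = gram (inner g) c x j i.
Proof.
by rewrite /gram 2!mxE; exact: inner_sym.
Qed.

Lemma metric_unitmx (p : M) : metric_mx g p \in unitmx.
Proof.
rewrite -row_free_unit -kermx_eq0; apply/rowV0P => v /sub_kermxP vA.
apply/eqP/negP => /negP v0; have := metric_posdef g p v0.
by rewrite /form_of_mx vA mul0mx mxE ltxx.
Qed.

Lemma geodesic_C1 (gamma : R -> M) : geodesic g gamma -> C1_curve gamma.
Proof.
move=> [cg dg]; split=> // c ac t ct; have [dx ddx _] := dg c ac t ct.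
split; first exact: dx.
have ddiff : differentiable (derive1 (c \o gamma)) t by apply/derivable1_diffP.
exact: differentiable_continuous ddiff.
Qed.

(** The derivative of the squared speed at [t0] is computed in the chart
    preferred at [gamma t0]: there the Gram matrix is the metric matrix itself,
    so that it is invertible and [christoffel_energy] applies. *)
Lemma geodesic_speed_cst (gamma : R -> M) : geodesic g gamma ->
  forall s t, tnorm g (velocity gamma s) = tnorm g (velocity gamma t).
Proof.
move=> [cg dg] s t; rewrite /tnorm; congr Num.sqrt; move: s t.
suff dE t0 : is_derive t0 (1 : R) (fun t => inner g (velocity gamma t) (velocity gamma t)) 0.
  by move=> s t; exact: (is_derive_0_is_cst s t dE).
set c := chart_at (gamma t0).
have ac : atlas c by exact: atlas_chart_at.
have ct0 : cdom c (gamma t0) by exact: cdom_chart_at.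
have cx0 : cran c (c (gamma t0)) by exists (gamma t0).
pose x := c \o gamma.
have [dx ddx geq] := dg c ac t0 ct0.
pose G i j := fun y => gram (inner g) c y i j.
pose v := derive1 x.
have near_E : \forall t \near t0,
    \sum_i \sum_j v t 0 i * v t 0 j * G i j (x t) =
    inner g (velocity gamma t) (velocity gamma t).
  have ct : \forall t \near t0, cdom c (gamma t).
    by apply: cg; apply: open_nbhs_nbhs; split => //; exact: cdom_open.
  apply: filterS ct => t ct; have [dxt _ _] := dg c ac t ct.
  by rewrite (inner_velocityE g _ _ _ cg ac ct dxt).
apply: near_eq_is_derive near_E _.
pose a := derive1 v t0.
have dv i : is_derive t0 (1 : R) (fun t => v t 0 i) (a 0 i).
  have /derivable_mxP/(_ 0 i) dvi := ddx.
  by apply: DeriveDef => //; rewrite /a derive1E derive_mx// mxE.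
have dG i j : is_derive t0 (1 : R) (fun t => G i j (x t))
    (\sum_l v t0 0 l * partial l (G i j) (x t0)).
  have dGij : differentiable (G i j) (x t0).
    by have [] := metric_smooth g ac i j 1 => + _; apply.
  have [dGx GxE] := is_derive_comp_curve _ _ _ dx dGij.
  apply: DeriveDef => //; rewrite GxE {1}(row_sum_delta (derive1 x t0)) linear_sum.
  by apply: eq_bigr => l _; rewrite linearZ/= /partial deriveE.
have -> : (fun t => \sum_i \sum_j v t 0 i * v t 0 j * G i j (x t)) =
  \sum_i \sum_j (fun t => v t 0 i * v t 0 j * G i j (x t)).
  by apply/funext => t; rewrite fct_sumE; apply: eq_bigr => i _; rewrite fct_sumE.
apply: is_derive_eq.
rewrite -[RHS](@christoffel_energy _ _ (gram (inner g) c (x t0))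
  (invmx (gram (inner g) c (x t0)))
  (fun l i j => partial l (G i j) (x t0)) (fun i => v t0 0 i) (fun i => a 0 i)).
- apply: eq_bigr => i _; apply: eq_bigr => j _; rewrite /G /GRing.scale/=; ring.
- by rewrite mulmxV// gram_chart_at metric_unitmx.
- by move=> i j; exact: gram_sym.
- by move=> k; exact: geq.
Qed.

Lemma C1_curve_affine (gamma : R -> M) (a b : R) : C1_curve gamma ->
  C1_curve (fun s => gamma (a * s + b)).
Proof.
move=> [cg dg].
have caff : continuous (fun s : R => a * s + b).
  move=> s; apply: cvgD; last exact: cvg_cst.
  by apply: cvgM; [exact: cvg_cst|exact: cvg_id].
split; first by move=> s; apply: continuous_comp; [exact: caff|exact: cg].
move=> c ac s cs; have [dx cdx] := dg c ac _ cs.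
split; first exact: (@ex_derive _ _ _ _ _ _ _ (is_derive_affine _ _ _ _ dx)).
have near_d : \forall s \near s, a *: derive1 (c \o gamma) (a * s + b) =
    derive1 (c \o (fun s => gamma (a * s + b))) s.
  have ct : \forall t \near a * s + b, cdom c (gamma t).
    by apply: cg; apply: open_nbhs_nbhs; split => //; exact: cdom_open.
  have {}ct : \forall s0 \near s, cdom c (gamma (a * s0 + b)) by exact: (caff s _ ct).
  apply: filterS ct => s' ct; have [dx' _] := dg c ac _ ct.
  by rewrite [RHS]derive1E (@derive_val _ _ _ _ _ _ _ (is_derive_affine _ _ _ _ dx')).
set h := derive1 (c \o _).
rewrite (_ : {for s, continuous h} = (h x @[x --> s] --> h s)); last by [].
rewrite -[h s](nbhs_singleton near_d).
apply: cvg_trans; first exact: near_eq_cvg near_d.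
apply: cvgZ; first exact: cvg_cst.
by apply: (continuous_comp (f := fun s => a * s + b)); [exact: caff|exact: cdx].
Qed.

Lemma velocity_affine (gamma : R -> M) (a b s : R) : C1_curve gamma ->
  velocity (fun s => gamma (a * s + b)) s = a *: (velocity gamma (a * s + b) : 'rV[R]_m)
  :> 'rV[R]_m.
Proof.
move=> [_ dg].
have [dx _] := dg _ (atlas_chart_at _) (a * s + b) (cdom_chart_at _).
by rewrite /velocity derive1E (@derive_val _ _ _ _ _ _ _ (is_derive_affine _ _ _ _ dx)).
Qed.

Lemma tnormZ (p : M) (a : R) (v : tangent p) :
  tnorm g (a *: (v : 'rV[R]_m) : tangent p) = `|a| * tnorm g v.
Proof.
rewrite /tnorm -sqrtr_sqr -sqrtrM ?sqr_ge0//; congr Num.sqrt.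
by rewrite /inner /form_of_mx linearZ/= -!scalemxAl -scalemxAr !mxE mulrA.
Qed.

(** The affine reparametrization covers both orientations: [a = t], [b = 0] goes
    from [gamma 0] to [gamma t], and [a = - t], [b = t] goes back. *)
Lemma geodesic_dist (gamma : R -> M) (a b : R) : geodesic g gamma ->
  (dist g (gamma b) (gamma (a + b)%R) <= (`|a| * tnorm g (velocity gamma 0%R))%:E)%E.
Proof.
move=> geog; have C1g := geodesic_C1 _ geog.
have := dist_le_curve g _ (C1_curve_affine _ a b C1g).
rewrite mulr0 add0r mulr1 => /le_trans; apply.
rewrite /curve_length (eq_integral (fun=> (`|a| * tnorm g (velocity gamma 0))%:E)).
  by rewrite integral_cst//= lebesgue_measure_itv/= lte_fin ltr01 oppr0 adde0 mule1.
move=> s _; rewrite (velocity_affine _ _ _ _ C1g) tnormZ.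
by rewrite (geodesic_speed_cst _ geog (a * s + b) 0).
Qed.

End Geodesics.

(** * The gap function and one step of the algorithm *)

Section VectorOrder.
Context {R : realType} {n : nat}.
Implicit Types x : 'rV[R]_n.+1.

Lemma le_vmax x i : x 0 i <= vmax x.
Proof. exact: (le_bigmax _ (fun i => x 0 i)). Qed.

Lemma vmaxZ_le (s : R) x : 0 <= s -> vmax (s *: x) <= s * vmax x.
Proof.
move=> s0; apply: bigmax_le => [|i _]; by rewrite mxE ler_wpM2l// le_vmax.
Qed.

Lemma vmin_le x i : vmin x <= x 0 i.
Proof. exact: (bigmin_le_cond _ (fun i => x 0 i)). Qed.

Lemma le_vmin x (a : R) : (forall i, a <= x 0 i) -> a <= vmin x.
Proof. by move=> ax; apply: le_bigmin => [|i _]; exact: ax. Qed.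

Lemma lt_vmin x (a : R) : (forall i, a < x 0 i) -> a < vmin x.
Proof. by move=> ax; apply: lt_bigmin => [|i _]; exact: ax. Qed.

End VectorOrder.

Section Descent.
Context {R : realType} {m n : nat} {M : smoothManifold R m}.
Variables (g : riemannianMetric M) (F : M -> 'rV[R]_n.+1).

Lemma JFZ (p : M) (s : R) (v : tangent p) :
  JF g F (s *: (v : 'rV[R]_m) : tangent p) = s *: JF g F v.
Proof.
apply/rowP => i; rewrite !mxE /inner /form_of_mx linearZ/= -scalemxAr mxE //.
Qed.

(** A minimizer [v] is no worse than its multiples [s *: v] with [s >= 0], and
    optimality at [s = 1] forces [vmax (JF v) <= - |v|^2].  If there were no
    minimizer, [steepest] would be [0] and both sides would vanish. *)
Lemma alpha_star_le (p : M) :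
  alpha_star g F p <= - (2^-1 * tnorm g (steepest g F p) ^+ 2).
Proof.
rewrite /alpha_star /steepest; case: xgetP => [v _ v_min|_] /=; last first.
  have -> : (0 : 'rV[R]_m) = 0 *: (0 : 'rV[R]_m) by rewrite scale0r.
  rewrite /alpha_fun JFZ tnormZ normr0 mul0r expr0n mulr0 oppr0 addr0.
  by apply: le_trans (vmaxZ_le _ _ (lexx 0)) _; rewrite mul0r.
set a := vmax (JF g F (v : tangent p)); set b := tnorm g (v : tangent p) ^+ 2.
have b0 : 0 <= b by exact: sqr_ge0.
have ab s : 0 <= s -> a + 2^-1 * b <= s * a + 2^-1 * (s ^+ 2 * b).
  move=> s0; have := v_min (s *: (v : 'rV[R]_m)); rewrite /alpha_fun.
  rewrite -/a -/b.
  move=> /le_trans; apply; rewrite tnormZ exprMn real_normK ?num_real//.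
  by rewrite lerD2r JFZ; exact: vmaxZ_le.
suff : a + b <= 0 by rewrite /alpha_fun -/a -/b; lra.
rewrite leNgt; apply/negP => ab0.
have [b_eq0|b_neq0] := eqVneq b 0.
  have := ab 0 (lexx 0); rewrite b_eq0; lra.
have bgt0 : 0 < b by rewrite lt_def b_neq0.
have [a0|a0] := leP 0 a.
  have := ab 0 (lexx 0); lra.
(* The minimizer over [s] of [s a + s^2 b / 2]. *)
pose s := - a / b.
have s0 : 0 <= s by rewrite divr_ge0// oppr_ge0 ltW.
have sE : s * b = - a by rewrite /s divfK.
have s1 : s < 1 by rewrite /s ltr_pdivrMr//; lra.
have := ab s s0; rewrite expr2 -mulrA sE.
have : 0 < (1 - s) * (a + b) by rewrite mulr_gt0// subr_gt0.
rewrite mulrBl mul1r mulrDr sE; lra.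
Qed.

Lemma D_set_descent (sigma : R) (p : M) (v : tangent p) i : sigma < 1 ->
  D_set g F sigma v ->
  JF g F v 0 i <= - ((1 - sigma) / 2 * tnorm g (steepest g F p) ^+ 2
                     + tnorm g v ^+ 2 / 2).
Proof.
move=> s1; rewrite /D_set /alpha_fun => hv.
have := le_vmax (JF g F v) i.
have : (1 - sigma) * alpha_star g F p <=
    (1 - sigma) * - (2^-1 * tnorm g (steepest g F p) ^+ 2).
  by rewrite ler_wpM2l ?subr_ge0 ?(ltW s1)// alpha_star_le.
move: hv; lra.
Qed.

Lemma vmin_le_phi (p q : M) : ((vmin (F p - F q))%:E <= phi F p)%E.
Proof. by apply: ereal_sup_ubound; exists q. Qed.

Lemma phi_ge0 (p : M) : (0 <= phi F p)%E.
Proof.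
apply: le_trans (vmin_le_phi p p); rewrite lee_fin subrr.
by apply: le_vmin => i; rewrite mxE.
Qed.

(** The gap to every competitor [q] decreases by [d], hence so does their
    supremum.  The inequality is stated with a sum because [phi] may be
    infinite. *)
Lemma phi_descent (p p' : M) (d : R) :
  (forall i, F p' 0 i <= F p 0 i - d) -> (phi F p' + d%:E <= phi F p)%E.
Proof.
move=> hd; rewrite -leeBrDr//; apply: ge_ereal_sup => _ [q _ <-].
rewrite leeBrDr// -EFinD; apply: le_trans (vmin_le_phi p q).
rewrite lee_fin; apply: le_vmin => i.
by have := vmin_le (F p' - F q) i; have := hd i; rewrite !mxE; lra.
Qed.

Lemma weak_paretoP (p : M) : weak_pareto F p <-> (phi F p <= 0)%E.
Proof.
split=> [wp|phi0 [q qp]].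
  apply: ge_ereal_sup => _ [q _ <-]; rewrite lee_fin leNgt; apply/negP => vq.
  apply: wp; exists q => i; rewrite -subr_gt0.
  by apply: lt_le_trans vq _; apply: le_trans (vmin_le _ i) _; rewrite !mxE.
have := le_trans (vmin_le_phi p q) phi0; rewrite lee_fin leNgt => /negP; apply.
by apply: lt_vmin => i; rewrite !mxE subr_gt0.
Qed.

Lemma generated_step (sigma beta Rmax : R) (p : nat -> M)
    (v : forall k, tangent (p k)) (t : nat -> R) (k : nat) :
  sigma < 1 -> 0 < beta -> generated g F sigma beta Rmax v t ->
  let w := tnorm g (v k) in
  let s := tnorm g (steepest g F (p k)) in
  [/\ 0 < t k <= Rmax,
      (dist g (p k) (p k.+1) <= (t k * w)%:E)%E,
      (dist g (p k.+1) (p k) <= (t k * w)%:E)%E &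
      (phi F (p k.+1) + (beta * t k * ((1 - sigma) / 2 * s ^+ 2 + w ^+ 2 / 2))%:E
        <= phi F (p k))%E].
Proof.
move=> s1 beta0 gen w s.
have [_ Dv /[dup] t0R /andP[t0 _] [gamma [geog g0 gv Fdec pS]]] := gen k.
have wE : tnorm g (velocity gamma 0) = w by rewrite /w /tnorm /inner /form_of_mx gv g0.
split=> //.
- have := geodesic_dist g gamma (t k) 0 geog.
  by rewrite wE addr0 g0 -pS gtr0_norm.
- have := geodesic_dist g gamma (- t k) (t k) geog.
  by rewrite wE addNr g0 -pS normrN gtr0_norm.
- apply: phi_descent => i; rewrite pS; apply: le_trans (Fdec i) _.
  rewrite !mxE lerD2l -mulrN ler_wpM2l ?mulr_ge0 ?(ltW t0) ?(ltW beta0)//.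
  by have := D_set_descent _ _ _ i s1 Dv; rewrite mxE.
Qed.

Hypothesis FC1 : C1_map F.

Lemma F_dist_continuous (p : M) (e : R) : 0 < e -> exists2 d : R, 0 < d &
  forall q, (dist g p q < d%:E)%E \/ (dist g q p < d%:E)%E ->
    forall i, `|F p 0 i - F q 0 i| <= e.
Proof.
move=> e0; apply: dist_small_nbhs.
apply: (@filter_forall _ _ (fun i q => `|F p 0 i - F q 0 i| <= e)
  (nbhs p) (nbhs_filter p)) => i.
by have /cvgrPdist_le/(_ e e0) := C1_fun_continuous _ (FC1 i) p.
Qed.

End Descent.

(** * Estimates on one step and geometric sequences *)

(** [a ^+ 2 - b ^+ 2 = (a - b) (a + b)] and [a + b <= 2 * a]. *)
Lemma sqrt_decrease {R : realFieldType} (a b k : R) : 0 <= a -> 0 <= b ->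
  k * a <= a ^+ 2 - b ^+ 2 -> (a = 0 -> k <= 0) -> 0 <= k -> k <= 2 * (a - b).
Proof.
move=> a0 b0 kab ak k0.
have ka0 : 0 <= k * a by rewrite mulr_ge0.
have ba : b <= a by rewrite -ler_sqr ?nnegrE//; lra.
have [a_eq0|a_neq0] := eqVneq a 0; first by have := ak a_eq0; lra.
have agt0 : 0 < a by rewrite lt_def a_neq0.
rewrite -(ler_pM2r agt0); apply: (le_trans kab).
have : (a - b) * (a + b) <= (a - b) * (2 * a) by rewrite ler_wpM2l//; lra.
by rewrite !expr2; lra.
Qed.

(** In this section [t] is the step size, [w] and [s] are the norms of the chosen
    and of the steepest direction, [f] and [f'] the values of the gap before and
    after the step; [fs] is the error bound and [ff'] the sufficient decrease. *)
Section StepEstimates.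
Context {R : rcfType}.
Variables (sigma beta alpha : R).
Hypotheses (Hsigma : 0 < sigma < 1) (beta0 : 0 < beta) (alpha0 : 0 < alpha).
Variables (t w s f f' : R).
Hypotheses (t0 : 0 < t) (w0 : 0 <= w) (s0 : 0 <= s) (f0 : 0 <= f) (f'0 : 0 <= f').
Hypothesis fs : alpha * f <= s ^+ 2.
Hypothesis ff' : f' + beta * t * ((1 - sigma) / 2 * s ^+ 2 + w ^+ 2 / 2) <= f.

Let s1 : sigma < 1. Proof. by case/andP: Hsigma. Qed.
Let bt0 : 0 < beta * t. Proof. exact: mulr_gt0. Qed.

Lemma step_length_sqr (Rmax : R) : t <= Rmax ->
  (t * w) ^+ 2 <= 2 * Rmax / beta * f.
Proof.
move=> tR; have ss0 : 0 <= (1 - sigma) / 2 * s ^+ 2.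
  by rewrite mulr_ge0 ?sqr_ge0// divr_ge0// subr_ge0 ltW.
have : beta * t * (w ^+ 2 / 2) <= f.
  have : beta * t * (w ^+ 2 / 2) <= beta * t * ((1 - sigma) / 2 * s ^+ 2 + w ^+ 2 / 2).
    by rewrite ler_pM2l// lerDr.
  by move: ff' f'0; lra.
move=> h; have tw0 : 0 <= t * w ^+ 2 by rewrite mulr_ge0 ?sqr_ge0 ?ltW.
have h2 : t * w ^+ 2 <= 2 / beta * f.
  by rewrite mulrAC ler_pdivlMr//; lra.
have : t * (t * w ^+ 2) <= Rmax * (2 / beta * f).
  by apply: ler_pM => //; exact: ltW.
have -> : (t * w) ^+ 2 = t * (t * w ^+ 2) by ring.
by move=> /le_trans; apply; rewrite le_eqVlt; apply/orP; left; apply/eqP; ring.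
Qed.

(** The arithmetic-geometric inequality turns the decrease into
    [beta * t * sqrt (1 - sigma) * s * w], and the error bound gives
    [s >= sqrt alpha * sqrt f]; dividing by [sqrt f] leaves a bound on the step
    length that telescopes and does not involve a lower bound on [t]. *)
Lemma step_length_sqrt :
  t * w <= 2 / (beta * (Num.sqrt (1 - sigma) * Num.sqrt alpha)) *
           (Num.sqrt f - Num.sqrt f').
Proof.
set c := _ * Num.sqrt alpha.
have c0 : 0 < c by rewrite mulr_gt0 ?sqrtr_gt0// subr_gt0.
have bc0 : 0 < beta * c by exact: mulr_gt0.
rewrite mulrAC ler_pdivlMr//.
apply: sqrt_decrease; rewrite ?sqrtr_ge0//.
- rewrite !sqr_sqrtr//.
  have sE : Num.sqrt alpha * Num.sqrt f <= s.
    by rewrite -sqrtrM ?(ltW alpha0)// -[s]ger0_norm// -sqrtr_sqr ler_wsqrtr.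
  have amgm : Num.sqrt (1 - sigma) * s * w <= (1 - sigma) / 2 * s ^+ 2 + w ^+ 2 / 2.
    have := sqr_ge0 (Num.sqrt (1 - sigma) * s - w).
    rewrite sqrrB exprMn sqr_sqrtr ?subr_ge0 ?(ltW s1)//; lra.
  have : beta * t * (Num.sqrt (1 - sigma) * (Num.sqrt alpha * Num.sqrt f) * w) <=
     beta * t * ((1 - sigma) / 2 * s ^+ 2 + w ^+ 2 / 2).
    rewrite ler_pM2l//; apply: le_trans amgm; rewrite ler_wpM2r// ler_wpM2l//.
  have -> : t * w * (beta * c) * Num.sqrt f =
    beta * t * (Num.sqrt (1 - sigma) * (Num.sqrt alpha * Num.sqrt f) * w).
    by rewrite /c; ring.
  by move: ff'; lra.
- move=> /eqP; rewrite sqrtr_eq0 => f_le0.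
  have : (t * w) ^+ 2 <= 0.
    have := @step_length_sqr t (lexx t); have -> : f = 0 by apply/eqP; rewrite eq_le f_le0.
    by rewrite mulr0.
  rewrite real_exprn_even_le0//= ?num_real// => /eqP ->; lra.
- by rewrite mulr_ge0// ?mulr_ge0// ltW.
Qed.

(** [(1 - sqrt sigma)^2 <= 1 - sigma], so that the part of the decrease in [s]
    already accounts for the factor.  When the expression under the root is
    negative the root is [0], and so is [sqrt f']. *)
Lemma step_contraction (tinf : R) : 0 <= tinf <= t ->
  Num.sqrt f' <=
  Num.sqrt (1 - alpha * beta * tinf * (1 - Num.sqrt sigma) ^+ 2 / 2) * Num.sqrt f.
Proof.
move=> /andP[ti0 tit]; rewrite mulrC -sqrtrM//; apply: ler_wsqrtr.
have sg0 : 0 <= sigma by case/andP: Hsigma => /ltW.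
have sq0 := sqrtr_ge0 sigma.
have sq1 : Num.sqrt sigma < 1 by rewrite -sqrtr1 ltr_sqrt.
have sg : (1 - Num.sqrt sigma) ^+ 2 <= 1 - sigma.
  rewrite -{2}(sqr_sqrtr sg0).
  have : 0 <= Num.sqrt sigma * (1 - Num.sqrt sigma) by rewrite mulr_ge0//; lra.
  by rewrite !expr2; lra.
have : beta * tinf * ((1 - Num.sqrt sigma) ^+ 2 * (alpha * f)) <=
       beta * t * ((1 - sigma) * s ^+ 2).
  apply: ler_pM.
  - by rewrite mulr_ge0// ltW.
  - by rewrite mulr_ge0 ?sqr_ge0// mulr_ge0// ltW.
  - by rewrite ler_pM2l.
  - by apply: ler_pM => //; rewrite ?sqr_ge0// mulr_ge0// ltW.
have : 0 <= beta * t * (w ^+ 2 / 2).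
  by apply: mulr_ge0; [exact: ltW|rewrite divr_ge0 ?sqr_ge0].
by move: ff'; lra.
Qed.

End StepEstimates.

Lemma expr_lt1_small {R : realType} (A rho e : R) : 0 <= A -> 0 <= rho < 1 -> 0 < e ->
  exists N : nat, forall k, (N <= k)%N -> A * rho ^+ k <= e.
Proof.
move=> A0 /andP[rho0 rho1] e0.
have rn : `|rho| < 1 by rewrite ger0_norm.
have : A * rho ^+ k @[k --> \oo] --> A * 0 by apply: cvgMl_tmp; exact: cvg_expr.
rewrite mulr0 => /cvgrPdist_le/(_ e e0)[N _ hN]; exists N => k Nk.
have := hN k Nk; rewrite sub0r normrN ger0_norm// mulr_ge0// exprn_ge0//.
Qed.

Section GeometricSequences.
Context {R : realType} {m : nat} {M : smoothManifold R m}.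
Variable g : riemannianMetric M.

Lemma dist_refl (p : M) : (dist g p p <= 0)%E.
Proof. by apply: ereal_inf_lbound; exists [::] => //; rewrite big_nil. Qed.

Variables (u : nat -> M) (a : nat -> R) (rho D : R).
Hypotheses (rho01 : 0 <= rho < 1) (D0 : 0 <= D) (a0 : forall k, 0 <= a k)
  (a_contr : forall k, a k.+1 <= rho * a k)
  (step : forall k, (dist g (u k) (u k.+1) <= (D * (1 - rho) * a k)%:E)%E)
  (step' : forall k, (dist g (u k.+1) (u k) <= (D * (1 - rho) * a k)%:E)%E).

Lemma geometric_decay k : a k <= rho ^+ k * a 0%N.
Proof.
case/andP: rho01 => rho0 _.
elim: k => [|k IH]; first by rewrite expr0 mul1r.
by apply: le_trans (a_contr k) _; rewrite exprS -mulrA ler_wpM2l.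
Qed.

(** [D * a k] absorbs the first step and the remaining bound [D * a k.+1], because
    [D * (1 - rho) * a k + D * (rho * a k) = D * a k]; this sums the geometric
    series without writing it. *)
Lemma geometric_dist j k :
  (dist g (u k) (u (k + j)%N) <= (D * a k)%:E)%E /\
  (dist g (u (k + j)%N) (u k) <= (D * a k)%:E)%E.
Proof.
elim: j k => [|j IH] k.
  rewrite addn0; have : (dist g (u k) (u k) <= (D * a k)%:E)%E.
    by apply: le_trans (dist_refl _) _; rewrite lee_fin mulr_ge0.
  by [].
have [IH1 IH2] := IH k.+1; rewrite addnS -addSn.
have le_sum : D * (1 - rho) * a k + D * a k.+1 <= D * a k.
  have : D * a k.+1 <= D * (rho * a k) by rewrite ler_wpM2l.
  lra.
split; apply: le_trans (dist_triangle g _ (u k.+1) _) _.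
  by apply: le_trans (leeD (step k) IH1) _; rewrite -EFinD lee_fin.
by apply: le_trans (leeD IH2 (step' k)) _; rewrite -EFinD lee_fin addrC.
Qed.

Lemma geometric_limit : complete_metric g ->
  exists q, (forall k, (dist g (u k) q <= (D * a k)%:E)%E) /\
    forall e, 0 < e -> exists N : nat, forall i : nat,
      (N <= i)%N -> (dist g (u i) q <= e%:E)%E.
Proof.
move=> cpl.
have small e : 0 < e -> exists N : nat, forall k, (N <= k)%N -> D * a k <= e.
  move=> e0; have [N hN] := expr_lt1_small (D * a 0%N) rho e (mulr_ge0 D0 (a0 0%N)) rho01 e0.
  exists N => k /hN; apply: le_trans; rewrite -mulrA ler_wpM2l// mulrC.
  exact: geometric_decay.
have [|q hq] := cpl u.
  move=> e e0; have [N hN] := small e e0; exists N => i j Ni Nj.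
  have [ij|/ltnW ji] := leqP i j.
    rewrite -(subnKC ij); apply: le_trans (geometric_dist _ _).1 _.
    by rewrite lee_fin hN.
  rewrite -(subnKC ji); apply: le_trans (geometric_dist _ _).2 _.
  by rewrite lee_fin hN.
exists q; split=> // k; apply/lee_addgt0Pr => e e0.
have [N hN] := hq e e0.
apply: le_trans (dist_triangle g _ (u (k + N)%N) _) _.
by apply: leeD; [exact: (geometric_dist N k).1|apply: hN; exact: leq_addl].
Qed.

End GeometricSequences.

(** * Behaviour of the gap function near weak Pareto optima *)

Section Gap.
Context {R : realType} {m n : nat} {M : smoothManifold R m}.
Variables (g : riemannianMetric M) (F : M -> 'rV[R]_n.+1).
Hypothesis FC1 : C1_map F.

Lemma phi_small_near (p : M) (e : R) : weak_pareto F p -> 0 < e ->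
  exists2 d : R, 0 < d & forall q, (dist g p q < d%:E)%E -> (phi F q <= e%:E)%E.
Proof.
move=> /weak_paretoP wp e0; have [d d0 hd] := F_dist_continuous g F FC1 p e e0.
exists d => // q pq.
have : (phi F q + (- e)%:E <= phi F p)%E.
  apply: phi_descent => i; have := hd q (or_introl pq) i.
  by rewrite ler_distl; lra.
by move=> /le_trans/(_ wp); rewrite EFinN sube_le0.
Qed.

(** If [q'] dominated [q] strictly, it would dominate the nearby [u i] by a
    margin bounded away from [0], against [phi F (u i) -> 0]. *)
Lemma weak_pareto_limit (u : nat -> M) (q : M) :
  (forall e : R, 0 < e -> exists N : nat, forall i, (N <= i)%N ->
     (dist g (u i) q <= e%:E)%E) ->
  (forall e : R, 0 < e -> exists N : nat, forall i, (N <= i)%N ->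
     (phi F (u i) <= e%:E)%E) ->
  weak_pareto F q.
Proof.
move=> uq phi0 [q' q'q].
pose e := vmin (F q - F q').
have e0 : 0 < e by apply: lt_vmin => i; rewrite !mxE subr_gt0.
have e30 : 0 < e / 3 by rewrite divr_gt0.
have [d d0 hd] := F_dist_continuous g F FC1 q (e / 3) e30.
have d20 : 0 < d / 2 by rewrite divr_gt0.
have [N1 h1] := uq _ d20; have [N2 h2] := phi0 _ e30.
pose k := (N1 + N2)%N.
have kq : (dist g (u k) q < d%:E)%E.
  by apply: le_lt_trans (h1 k (leq_addr _ _)) _; rewrite lte_fin; lra.
suff : 2 * (e / 3) <= e / 3 by lra.
rewrite -lee_fin; apply: le_trans (h2 k (leq_addl _ _)).
apply: le_trans (vmin_le_phi F _ q'); rewrite lee_fin; apply: le_vmin => i.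
have := vmin_le (F q - F q') i; have := hd (u k) (or_intror kq) i.
by rewrite ler_distl -/e !mxE; lra.
Qed.

End Gap.

(** * Linear convergence *)

Theorem theorem4p1 (R : realType) (m n : nat)
    (M : smoothManifold R m) (g : riemannianMetric M)
    (Mconnected : connected [set: M]) (Mcomplete : complete_metric g)
    (F : M -> 'rV[R]_n.+1) (FC1 : C1_map F)
    (sigma beta Rmax : R)
    (Hsigma : 0 < sigma < 1) (Hbeta : 0 < beta < 1) (HR : 1 <= Rmax)
    (pbar : M) (Hpbar : weak_pareto F pbar)
    (alpha r : R) (Halpha : 0 < alpha) (Hr : 0 < r)
    (Hphi : forall p : M, cball g pbar r p ->
      (alpha%:E * phi F p <= (tnorm g (steepest g F p) ^+ 2)%:E)%E) :
  exists delta : R, 0 < delta /\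
    forall (p : nat -> M) (v : forall k, tangent (p k)) (t : nat -> R),
      generated g F sigma beta Rmax v t ->
      (forall k, s_compatible g F (v k)) ->
      cball g pbar delta (p 0%N) ->
      let tinf : R := inf (range t) in
      let rho : R :=
        Num.sqrt (1 - alpha * beta * tinf * (1 - Num.sqrt sigma) ^+ 2 / 2) in
      let mu : R := 2 * Rmax / ((1 - rho) ^+ 2 * beta) in
      0 < tinf ->
      (forall k, cball g pbar r (p k)) /\
      exists pstar : M,
        [/\ weak_pareto F pstar, converges_linearly g p pstar &
            forall k,
              (dist g (p k) pstar ^+ 2 <= mu%:E * phi F (p k))%E /\
              (mu%:E * phi F (p k) <= (mu * rho ^+ (2 * k))%:E * phi F (p 0%N))%E].
Proof.
have [s0 s1] := andP Hsigma; have [b0 b1] := andP Hbeta.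
have R0 : 0 < Rmax by exact: lt_le_trans HR.
(* The constant of [step_length_sqrt]. *)
pose K := 2 / (beta * (Num.sqrt (1 - sigma) * Num.sqrt alpha)).
have K0 : 0 < K by rewrite divr_gt0// !mulr_gt0 ?sqrtr_gt0 ?subr_gt0.
have phi_fin q : cball g pbar r q -> phi F q \is a fin_num.
  move=> /Hphi hq; rewrite ge0_fin_numE ?phi_ge0// ltey; apply/eqP => phiE.
  by move: hq; rewrite phiE gt0_muley ?lte_fin// leye_eq.
(* If [phi] is at most [eta] at the start, the run is no longer than [r / 2]. *)
pose eta := (r / (2 * K)) ^+ 2.
have rK0 : 0 < r / (2 * K) by rewrite divr_gt0// mulr_gt0.
have eta0 : 0 < eta by rewrite exprn_gt0.
have [d d0 hd] := phi_small_near g F FC1 pbar eta Hpbar eta0.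
pose delta := Num.min (d / 2) (r / 2).
exists delta; split; first by rewrite lt_min !divr_gt0.
move=> p v t gen _ p0 tinf rho mu tinf0.
have delta_d : delta < d by rewrite gt_min; apply/orP; left; lra.
have delta_r : delta <= r / 2 by rewrite ge_min lexx orbT.
pose f k := fine (phi F (p k)).
pose w k := tnorm g (v k).
pose s k := tnorm g (steepest g F (p k)).
have f0 k : 0 <= f k by rewrite fine_ge0// phi_ge0.
have Kf0 : K * Num.sqrt (f 0%N) <= r / 2.
  have : f 0%N <= eta.
    rewrite -lee_fin fineK; first by apply: hd; apply: le_lt_trans p0 _; rewrite lte_fin.
    apply: phi_fin; apply: le_trans p0 _; rewrite lee_fin; lra.
  move=> /ler_wsqrtr; rewrite sqrtr_sqr ger0_norm ?(ltW rK0)//.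
  move=> /(ler_wpM2l (ltW K0)) /le_trans; apply.
  have -> : K * (r / (2 * K)) = r / 2; last by [].
  by field; rewrite gt_eqF.
have step_fin k : phi F (p k) \is a fin_num ->
    phi F (p k.+1) \is a fin_num /\
    f k.+1 + beta * t k * ((1 - sigma) / 2 * s k ^+ 2 + w k ^+ 2 / 2) <= f k.
  move=> fk; have [_ _ _ dec] := generated_step g F sigma beta Rmax p v t k s1 b0 gen.
  have fk1 : phi F (p k.+1) \is a fin_num.
    rewrite ge0_fin_numE ?phi_ge0// ltey; apply/eqP => phiE.
    by move: dec; rewrite phiE addye// leye_eq => /eqP E; rewrite E in fk.
  by split=> //; rewrite -lee_fin EFinD /f !fineK.
have t_bd k : 0 < t k <= Rmax by have [] := gen k.
have fs k : cball g pbar r (p k) -> alpha * f k <= s k ^+ 2.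
  by move=> pk; rewrite -lee_fin EFinM fineK ?phi_fin//; exact: Hphi.
have w0 k : 0 <= w k by exact: sqrtr_ge0.
have ss0 k : 0 <= s k by exact: sqrtr_ge0.
(* Being in the ball and the telescoped length bound feed each other: the error
   bound that gives the next step length is only known in the ball. *)
have stay k : cball g pbar r (p k) /\
    (dist g pbar (p k) <= (delta + K * (Num.sqrt (f 0%N) - Num.sqrt (f k)))%:E)%E.
  elim: k => [|k [pk IH]].
    split; last by rewrite subrr mulr0 addr0.
    by apply: le_trans p0 _; rewrite lee_fin; lra.
  have [fk1 dec] := step_fin k (phi_fin _ pk).
  have [tk0 _] := andP (t_bd k).
  have [_ dk _ _] := generated_step g F sigma beta Rmax p v t k s1 b0 gen.
  have tw := step_length_sqrt sigma beta alpha Hsigma b0 Halpha (t k) (w k) (s k)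
    (f k) (f k.+1) tk0 (w0 k) (ss0 k) (f0 k) (f0 k.+1) (fs k pk) dec.
  have pk1 : (dist g pbar (p k.+1) <=
      (delta + K * (Num.sqrt (f 0%N) - Num.sqrt (f k.+1)))%:E)%E.
    apply: le_trans (dist_triangle g _ (p k) _) _.
    apply: le_trans (leeD IH dk) _; rewrite -EFinD lee_fin.
    by rewrite -/(w k); move: tw; rewrite -/K; lra.
  split=> //; apply: le_trans pk1 _; rewrite lee_fin.
  have : 0 <= K * Num.sqrt (f k.+1) by rewrite mulr_ge0 ?sqrtr_ge0// ltW.
  lra.
have in_ball k : cball g pbar r (p k) := (stay k).1.
split=> //.
have phiE k : phi F (p k) = (f k)%:E by rewrite fineK// phi_fin.
have tinf_le k : 0 <= tinf <= t k.
  rewrite ltW//=; apply: ge_inf; last by exists k.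
  by exists 0 => _ [j _ <-]; have /andP[/ltW] := t_bd j.
have dec k := (step_fin k (phi_fin _ (in_ball k))).2.
have contr k : Num.sqrt (f k.+1) <= rho * Num.sqrt (f k).
  have [tk0 _] := andP (t_bd k).
  exact: (step_contraction sigma beta alpha Hsigma b0 Halpha (t k) (w k) (s k) (f k)
    (f k.+1) tk0 (f0 k) (fs k (in_ball k)) (dec k) tinf (tinf_le k)).
have rho0 : 0 <= rho by exact: sqrtr_ge0.
have rho1 : rho < 1.
  rewrite -[ltRHS]sqrtr1 ltr_sqrt// gtrDl oppr_lt0 divr_gt0//.
  apply: mulr_gt0; first by rewrite !mulr_gt0.
  by rewrite exprn_gt0// subr_gt0 -sqrtr1 ltr_sqrt.
have rho01 : 0 <= rho < 1 by rewrite rho0.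
have r10 : 0 < 1 - rho by rewrite subr_gt0.
pose D := Num.sqrt (2 * Rmax / beta) / (1 - rho).
have D0 : 0 <= D by rewrite divr_ge0 ?sqrtr_ge0// ltW.
have C0 : 0 <= 2 * Rmax / beta by rewrite divr_ge0 ?mulr_ge0// ltW.
have Dsq : D ^+ 2 = mu.
  by rewrite /D exprMn sqr_sqrtr// exprVn /mu; field; rewrite !gt_eqF.
have len k : t k * w k <= D * (1 - rho) * Num.sqrt (f k).
  have [tk0 tkR] := andP (t_bd k).
  rewrite /D divfK ?gt_eqF// -sqrtrM// -[leLHS]ger0_norm; last by rewrite mulr_ge0// ltW.
  rewrite -sqrtr_sqr ler_wsqrtr//.
  exact: (step_length_sqr sigma beta Hsigma b0 (t k) (w k) (s k) (f k) (f k.+1)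
    tk0 (f0 k.+1) (dec k) Rmax tkR).
have hop k : (dist g (p k) (p k.+1) <= (D * (1 - rho) * Num.sqrt (f k))%:E)%E /\
             (dist g (p k.+1) (p k) <= (D * (1 - rho) * Num.sqrt (f k))%:E)%E.
  have [_ dk dk' _] := generated_step g F sigma beta Rmax p v t k s1 b0 gen.
  by split; [apply: le_trans dk _|apply: le_trans dk' _]; rewrite lee_fin; exact: len.
have [pstar [dpstar cvg_pstar]] := geometric_limit g p (fun k => Num.sqrt (f k)) rho D
  rho01 D0 (fun k => sqrtr_ge0 _) contr (fun k => (hop k).1) (fun k => (hop k).2) Mcomplete.
have decay k : Num.sqrt (f k) <= rho ^+ k * Num.sqrt (f 0%N).
  exact: (geometric_decay (fun k => Num.sqrt (f k)) rho rho01 contr k).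
have fdecay k : f k <= rho ^+ (2 * k) * f 0%N.
  rewrite -(sqr_sqrtr (f0 k)) -(sqr_sqrtr (f0 0%N)) mulnC exprM -exprMn.
  by rewrite ler_sqr ?nnegrE ?mulr_ge0 ?exprn_ge0 ?sqrtr_ge0.
have mu0 : 0 <= mu by rewrite -Dsq sqr_ge0.
exists pstar; split.
- apply: (weak_pareto_limit g F FC1 p) => // e e0.
  have [N hN] := expr_lt1_small (f 0%N) rho e (f0 0%N) rho01 e0.
  exists N => k Nk; rewrite phiE lee_fin; apply: le_trans (fdecay k) _.
  by rewrite mulrC hN// mul2n -addnn (leq_trans Nk)// leq_addr.
- (* [rho] and [f 0] may vanish, whence the maximum and the [+ 1]. *)
  exists (D * Num.sqrt (f 0%N) + 1), (Num.max rho (1 / 2)); split.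
  + by rewrite ltr_wpDl// mulr_ge0 ?sqrtr_ge0.
  + by rewrite lt_max gt_max rho1; apply/andP; split; [apply/orP; right|]; lra.
  + move=> k; apply: le_trans (dpstar k) _; rewrite lee_fin.
    have th : rho ^+ k <= Num.max rho (1 / 2) ^+ k.
      by rewrite lerXn2r ?nnegrE ?le_max ?rho0 ?lexx.
    apply: (@le_trans _ _ (D * Num.sqrt (f 0%N) * Num.max rho (1 / 2) ^+ k)).
      rewrite -mulrA ler_wpM2l// (le_trans (decay k))// mulrC ler_wpM2l//.
    by rewrite ler_wpM2r ?lerDl// exprn_ge0// le_max rho0.
- move=> k; rewrite !phiE -!EFinM lee_fin; split; last by rewrite -(mulrA mu) ler_wpM2l.
  rewrite -Dsq -(sqr_sqrtr (f0 k)) -exprMn.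
  have dfin : dist g (p k) pstar \is a fin_num.
    by rewrite ge0_fin_numE ?dist_ge0// (le_lt_trans (dpstar k))// ltry.
  have := dpstar k; rewrite -(fineK dfin) -EFin_expe !lee_fin => h.
  by rewrite ler_sqr ?nnegrE ?fine_ge0 ?dist_ge0// mulr_ge0 ?sqrtr_ge0.
Qed.
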